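(* Let $p$ be a prime, $e\ge1$, $q=p^e$, $G=\mathrm{SL}_2(\mathbb{F}_q)$, and fix an injective group homomorphism $\iota:\mathbb{F}_{q^2}^\times\to\mathbb{C}^\times$. For a root of unity $\zeta\in\mathbb{F}_{q^2}^\times$ of order dividing $q-1$ or $q+1$, let $A_\zeta=\pm I_2$ if $\zeta=\pm1$ and $A_\zeta=\begin{pmatrix}0&-1\\1&\zeta+\zeta^{-1}\end{pmatrix}$ otherwise. Let $\overline{V}$ be any finite-dimensional $\mathbb{F}_q[G]$-module with Brauer character $\psi_{\overline V}$. Then $$\dim_{\mathbb{F}_q}\mathrm{Hom}_{\mathbb{F}_q[G]}(\overline{\mathrm{st}},\overline{V})=\frac12\left(\frac1{q-1}\sum_{\zeta\in\mu_{q-1}}\psi_{\overline V}(A_\zeta)-\frac1{q+1}\sum_{\zeta\in\mu_{q+1}}\psi_{\overline V}(A_\zeta)\right).$$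
   Context: $\mu_{q\pm1}$ is the group of roots of unity of order dividing $q\pm1$ in $\mathbb{F}_{q^2}^\times$. The Steinberg module $\overline{\mathrm{st}}$ is the $\mathbb{F}_q$-span of the monomials $X^iY^{q-1-i}$ with $\binom{q-1}{i}\not\equiv0\pmod p$ inside the space of homogeneous degree-$(q-1)$ polynomials in $\mathbb{F}_q[X,Y]$, with $G$-action $\begin{pmatrix}a&b\\c&d\end{pmatrix}\cdot X^iY^j=(aX+cY)^i(bX+dY)^j$. Brauer character: for $g\in G$ of order prime to $p$, $\psi_{\overline V}(g)=\sum_i\iota(\alpha_i)$, where $\alpha_i$ runs over the eigenvalues (with multiplicity) of $g$ on $\overline V\otimes_{\mathbb{F}_q}\mathbb{F}_{q^2}$. When $p=2$, $\pm1$ denotes only $1$. *)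

(* Defs.v *)
From HB Require Import structures.
From mathcomp Require Import all_boot all_order all_algebra all_fingroup.
From mathcomp Require Import all_solvable all_field mxrepresentation.
From mathcomp Require Import reals complex mpoly.

Set Implicit Arguments.
Unset Strict Implicit.
Unset Printing Implicit Defensive.

Import Order.TTheory GRing.Theory Num.Theory.
Local Open Scope ring_scope.

Section SL2.
Variable F : finFieldType.

Definition SL2 : {set {'GL_2[F]}} := [set g | \det (GLval g) == 1].

Lemma SL2_group_set : group_set SL2.
Proof.
apply/group_setP; split=> [|g h]; first by rewrite inE GL_1E det1.
rewrite !inE => /eqP dg /eqP dh.
by rewrite GL_MxE det_mulmx dg dh mulr1.
Qed.

Canonical SL2_group := Group SL2_group_set.

Definition companion_mx (t : F) : 'M[F]_2 :=
  \matrix_(i, j) (if i == 0 then (if j == 0 then 0 else -1)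
                  else (if j == 0 then 1 else t)).

Lemma det_companion_mx t : \det (companion_mx t) = 1.
Proof.
rewrite (expand_det_row _ 0) !big_ord_recl big_ord0 /cofactor !det_mx11 !mxE /=.
by rewrite mul0r add0r addr0 expr1 mulr1 mulrNN mulr1.
Qed.

Lemma companion_mx_unit t : companion_mx t \is a GRing.unit.
Proof. by have /= := unitmxE (companion_mx t); rewrite det_companion_mx unitr1. Qed.

Lemma oppmx1_unit : (- 1 : 'M[F]_2) \is a GRing.unit.
Proof. exact: unitrN1. Qed.

End SL2.

Section ClassRepresentatives.
Variables (F L : finFieldType) (j : {rmorphism F -> L}).

(* A junk value is returned for x outside of j(F). For z in mu_(q-1) or
   mu_(q+1), z + z^-1 lies in j(F): see trace_descend. *)
Definition descend (x : L) : F := odflt 0 [pick t | j t == x].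

Lemma descendK t : descend (j t) = t.
Proof.
rewrite /descend; case: pickP => [u /eqP /fmorph_inj -> //|/(_ t)].
by rewrite eqxx.
Qed.

(* When F has characteristic 2, -1 = 1 and the first two cases agree. *)
Definition A_ (z : L) : {'GL_2[F]} :=
  if z == 1 then 1%g
  else if z == -1 then FinRing.Unit (oppmx1_unit F)
  else FinRing.Unit (companion_mx_unit (descend (z + z^-1))).

Lemma A_SL2 z : A_ z \in SL2 F.
Proof.
rewrite /A_; case: eqP => _; first exact: group1.
case: eqP => _; rewrite inE /=; last by rewrite det_companion_mx.
by rewrite -scaleN1r detZ det1 mulr1 sqrrN expr1n.
Qed.

Lemma fixed_descend (x : L) : x ^+ #|F| = x -> j (descend x) = x.
Proof.
move=> xq; rewrite /descend; case: pickP => [t /eqP //|nox].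
have q1 := finNzRing_gt1 F.
have szq : size ('X^#|F| - 'X : {poly L}) = #|F|.+1.
  by rewrite size_polyDl size_polyXn // size_polyN size_polyX ltnS.
have nz : ('X^#|F| - 'X : {poly L}) != 0 by rewrite -size_poly_eq0 szq.
have := max_poly_roots nz (rs := x :: [seq j t | t <- enum F]).
rewrite szq /= size_map -cardE ltnn => H; exfalso.
suff: false by [].
apply: H; last first.
  rewrite map_inj_uniq ?enum_uniq ?andbT; last exact: fmorph_inj.
  by apply/mapP => -[t _ xt]; have := nox t; rewrite -xt eqxx.
rewrite /root !hornerE xq subrr eqxx /=; apply/allP => _ /mapP[t _ ->].
by rewrite /root !hornerE -rmorphXn expf_card subrr.
Qed.

Lemma trace_descend p e z : prime p -> #|F| = (p ^ e)%N ->
  (z ^+ #|F|.-1 == 1) || (z ^+ #|F|.+1 == 1) ->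
  j (descend (z + z^-1)) = z + z^-1.
Proof.
move=> pp cF hz; apply: fixed_descend.
have chL : p \in [pchar L].
  by rewrite (fmorph_pchar j); exact: card_finPcharP cF pp.
rewrite exprDn_pchar; last first.
  by rewrite cF pnatX pnatE // chL.
have q0 : (0 < #|F|)%N by rewrite cF expn_gt0 prime_gt0.
rewrite exprVn; case/orP: hz => /eqP hz.
  by rewrite -(prednK q0) exprS hz mulr1.
have zz : z * z ^+ #|F| = 1 by rewrite -exprS.
have zE : z ^+ #|F| = z^-1.
  have z0 : z != 0 by apply/eqP => z0; move/eqP: zz; rewrite z0 mul0r eq_sym oner_eq0.
  by apply: (mulfI z0); rewrite zz divff.
by rewrite zE invrK addrC.
Qed.

End ClassRepresentatives.

Section Steinberg.
Variable F : finFieldType.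

Local Notation X := ('X_0 : {mpoly F[2]}).
Local Notation Y := ('X_1 : {mpoly F[2]}).

(* The columns of g: X is sent to aX + cY and Y to bX + dY. *)
Definition lin_subst (g : 'M[F]_2) : 2.-tuple {mpoly F[2]} :=
  [tuple g 0 0 *: X + g 1 0 *: Y; g 0 1 *: X + g 1 1 *: Y].

Lemma lin_subst_homog g i : tnth (lin_subst g) i \is 1.-homog.
Proof.
have h a b : a *: X + b *: Y \is 1.-homog.
  by apply: dhomogD; apply: dhomogZ; rewrite dhomogX /= mdeg1.
by case: i => -[|[|//]] lti; rewrite (tnth_nth 0) /=; exact: h.
Qed.

Lemma lin_subst_closed g d (f : {mpoly F[2]}) :
  f \is d.-homog -> f \mPo lin_subst g \is d.-homog.
Proof.
move=> /dhomogP fd; rewrite comp_mpolyE big_seq.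
apply: rpred_sum => m /fd /= <-; apply: dhomogZ.
rewrite /lin_subst mdegE !big_ord_recl !big_ord0 mulr1 addn0.
by apply: dhomogM; rewrite -[X in X.-homog]mul1n; apply: dhomogMn;
   exact: lin_subst_homog.
Qed.

Definition hpoly_act d (g : {'GL_2[F]}) (f : dhomog 2 F d) : dhomog 2 F d :=
  DHomog (lin_subst_closed g (dhomog_is_dhomog f)).

Lemma hpoly_act_linear d g : linear (@hpoly_act d g).
Proof. by move=> c u v; apply: val_inj; rewrite /= linearP. Qed.

HB.instance Definition _ d g :=
  GRing.isLinear.Build F _ _ _ (@hpoly_act d g) (hpoly_act_linear g).

Lemma hpoly_act1 d (f : dhomog 2 F d) : hpoly_act 1 f = f.
Proof.
apply: val_inj => /=; rewrite -[RHS]comp_mpoly_id; congr (_ \mPo _).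
by apply: eq_from_tnth => -[[|[|//]] lti]; rewrite tnth_mktuple (tnth_nth 0) /=
   !mxE /= ?scale1r ?scale0r ?addr0 ?add0r; congr 'X_ _; apply: val_inj.
Qed.

Lemma hpoly_actM d (g h : {'GL_2[F]}) (f : dhomog 2 F d) :
  hpoly_act (g * h)%g f = hpoly_act g (hpoly_act h f).
Proof.
apply: val_inj => /=; rewrite (comp_mpolyE _ (lin_subst h)).
rewrite comp_mpolyE raddf_sum /=.
apply: eq_bigr => m _; rewrite linearZ /=; congr (_ *: _).
rewrite rmorph_prod /=; apply: eq_bigr => i _; rewrite rmorphXn /=; congr (_ ^+ _).
have E a b : (a *: X + b *: Y) \mPo lin_subst g =
   a *: (g 0 0 *: X + g 1 0 *: Y) + b *: (g 0 1 *: X + g 1 1 *: Y).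
  by rewrite linearD !linearZ /= !comp_mpolyXU.
have o (k l : 'I_2) : GLval (g * h)%g k l = g k 0 * h 0 l + g k 1 * h 1 l.
  rewrite GL_ME mxE !big_ord_recl big_ord0 addr0.
  by congr (_ + g _ _ * h _ _); apply: val_inj.
have e : tnth (lin_subst (GLval (g * h)%g)) i = tnth (lin_subst h) i \mPo lin_subst g.
  case: i => -[|[|//]] lti; rewrite !(tnth_nth 0) /= E !scalerDr !scalerA;
  rewrite !o !scalerDl !(mulrC (h _ _)) -!addrA; congr (_ + _);
  by rewrite addrCA.
exact: e.
Qed.

Lemma monomial_homog d (i : 'I_d.+1) : X ^+ i * Y ^+ (d - i) \is d.-homog.
Proof.
rewrite -[X in X.-homog](subnKC (leq_ord i)).
by apply: dhomogM; rewrite -[X in X.-homog]mul1n; apply: dhomogMn;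
   rewrite dhomogX /= mdeg1.
Qed.

Definition monomial d (i : 'I_d.+1) : dhomog 2 F d := DHomog (monomial_homog i).

(* p is meant to be the characteristic of F. *)
Definition steinberg (p : nat) : {vspace dhomog 2 F #|F|.-1} :=
  <<[seq monomial i | i : 'I_#|F|.-1.+1 <- enum 'I_#|F|.-1.+1
                    & ~~ (p %| 'C(#|F|.-1, i))%N]>>%VS.

Lemma bin_pred_primeX p e i :
  prime p -> (i <= (p ^ e).-1)%N -> ~~ (p %| 'C((p ^ e).-1, i))%N.
Proof.
move=> pp; have q0 : (0 < p ^ e)%N by rewrite expn_gt0 prime_gt0.
elim: i => [_|i IH iq]; first by rewrite bin0 dvdn1; case: eqP pp => // ->.
have := IH (ltnW iq); apply: contra => pC.
rewrite -(dvdn_addr _ pC) -binS prednK //.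
have iq' : (i.+1 < p ^ e)%N by rewrite -(prednK q0) ltnS.
apply: contraLR iq' => npC; rewrite -leqNgt; apply: dvdn_leq => //.
have cop : coprime (p ^ e) 'C(p ^ e, i.+1) by rewrite coprimeXl // prime_coprime.
rewrite -(Gauss_dvdl _ cop) -[X in (_ %| _ * 'C(X, _))%N](prednK q0).
by rewrite -mul_bin_diag prednK // dvdn_mulr.
Qed.

Lemma steinberg_full p e : prime p -> #|F| = (p ^ e)%N ->
  steinberg p = fullv.
Proof.
move=> pp cF; apply/eqP; rewrite eqEsubv subvf /=; apply/subvP => f _.
have fE : f = \sum_(i < #|F|.-1.+1)
   (val f)@_[multinom (if k == ord0 then i : nat else #|F|.-1 - i)%N | k < 2] *: monomial i.
  apply: val_inj; rewrite raddf_sum /=; apply/mpolyP => m.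
  rewrite raddf_sum /=.
  have monE (i : 'I_#|F|.-1.+1) : X ^+ i * Y ^+ (#|F|.-1 - i) =
     'X_[[multinom (if k == ord0 then i : nat else #|F|.-1 - i)%N | k < 2]].
    rewrite [RHS]mpolyXE_id !big_ord_recl big_ord0 mulr1 !mnmE /=.
    by congr (_ * _); congr (_ ^+ _); congr 'X_ _; apply: val_inj.
  under eq_bigr => i _ do rewrite linearZ /= monE mcoeffX.
  have [dm|dm] := eqVneq (mdeg m) #|F|.-1; last first.
    rewrite (dhomog_nemf_coeff (dhomog_is_dhomog f)) // big1 // => i _.
    case: eqP => [me|_]; last by rewrite mulr0.
    case/eqP: dm; rewrite -me mdegE !big_ord_recl big_ord0 addn0 !mnmE /=.
    by rewrite subnKC // -ltnS.
  have m0 : (m 0%R < #|F|.-1.+1)%N.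
    by rewrite ltnS -dm mdegE !big_ord_recl leq_addr.
  have mE : [multinom (if k == ord0 then (Ordinal m0 : nat) else #|F|.-1 - Ordinal m0)%N | k < 2] = m.
    apply/mnmP => k; rewrite mnmE /=; case: eqP => [->//|k0].
    rewrite -dm mdegE !big_ord_recl big_ord0 addn0 addKn.
    by congr (m _); case: k k0 => -[|[|//]] ltk k0; apply: val_inj => //; case: k0; apply: val_inj.
  rewrite (bigD1 (Ordinal m0)) //= mE eqxx mulr1 big1 ?addr0 // => i im.
  case: eqP => [me|_]; last by rewrite mulr0.
  by case/eqP: im; apply: val_inj => /=; rewrite -me mnmE.
rewrite fE; apply: memv_suml => i _; apply: memvZ; apply: memv_span.
apply: map_f; rewrite mem_filter mem_enum andbT.
have := leq_ord i; move: (nat_of_ord i) => k; rewrite cF.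
exact: bin_pred_primeX.
Qed.

(* The projection vsproj is the identity here, steinberg p being stable: see
   vsval_steinberg_act. *)
Definition steinberg_act p (g : {'GL_2[F]}) (u : subvs_of (steinberg p)) :
    subvs_of (steinberg p) :=
  vsproj (steinberg p) (hpoly_act g (vsval u)).

Lemma vsval_steinberg_act p e g (u : subvs_of (steinberg p)) :
  prime p -> #|F| = (p ^ e)%N ->
  vsval (steinberg_act g u) = hpoly_act g (vsval u).
Proof. by move=> pp cF; apply: vsprojK; move: (hpoly_act _ _) => v; rewrite (steinberg_full pp cF) memvf. Qed.

Lemma steinberg_act_linear p g : linear (@steinberg_act p g).
Proof. by move=> c u v; rewrite /steinberg_act !linearP. Qed.

HB.instance Definition _ p g :=
  GRing.isLinear.Build F _ _ _ (@steinberg_act p g) (steinberg_act_linear g).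

End Steinberg.

Section Hom.
Variables (F : finFieldType) (p n : nat).
Variable rV : mx_representation F (SL2 F) n.

(* The F[SL2(F)]-module V afforded by rV is 'cV[F]_n, on which g acts on the
   left by u |-> rV g *m u; Hom_steinbergP characterises Hom_steinberg. *)
Definition hom_defect (g : {'GL_2[F]})
    (f : 'Hom(subvs_of (steinberg F p), 'cV[F]_n)) :
    'Hom(subvs_of (steinberg F p), 'cV[F]_n) :=
  linfun (fun u => f (steinberg_act g u) - rV g *m f u).

Lemma hom_defectE g f u :
  hom_defect g f u = f (steinberg_act g u) - rV g *m f u.
Proof.
have lin : linear (fun u => f (steinberg_act g u) - rV g *m f u).
  move=> c v w; rewrite !linearP /=.
  by rewrite scalerDr addrACA.
pose M := GRing.isLinear.Build F _ _ _ (fun u => f (steinberg_act g u) - rV g *m f u) lin.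
pose L : {linear _ -> _} := HB.pack (fun u => f (steinberg_act g u) - rV g *m f u) M.
exact: (lfunE L).
Qed.

Lemma hom_defect_linear g : linear (hom_defect g).
Proof.
move=> c f h; apply/lfunP => u; rewrite !(hom_defectE, add_lfunE, scale_lfunE).
by rewrite mulmxDr -scalemxAr scalerBr opprD addrACA.
Qed.

HB.instance Definition _ g :=
  GRing.isLinear.Build F _ _ _ (hom_defect g) (hom_defect_linear g).

Definition Hom_steinberg :
    {vspace 'Hom(subvs_of (steinberg F p), 'cV[F]_n)} :=
  (\bigcap_(g in SL2 F) lker (linfun (hom_defect g)))%VS.

Lemma Hom_steinbergP (f : 'Hom(subvs_of (steinberg F p), 'cV[F]_n)) :
  reflect (forall g, g \in SL2 F ->
             forall u, f (steinberg_act g u) = rV g *m f u)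
          (f \in Hom_steinberg).
Proof.
rewrite memvE; apply: (iffP subv_bigcapP) => [h g Gg u|h g Gg].
  move/(_ g Gg): h; rewrite -memvE memv_ker lfunE /= => /eqP/lfunP/(_ u).
  by rewrite hom_defectE lfunE /= => /eqP; rewrite subr_eq0 => /eqP.
rewrite -memvE memv_ker lfunE /=; apply/eqP/lfunP => u.
by rewrite hom_defectE lfunE /= h // subrr.
Qed.

End Hom.

Section BrauerCharacter.
Variables (F L : finFieldType) (j : {rmorphism F -> L}).
Variables (R : realType) (iota : L -> R[i]).

(* Eigenvalues are counted with their multiplicity in the characteristic
   polynomial, which splits over L when #|L| = #|F| ^ 2 and g in SL2(F) has
   order prime to the characteristic; the value is only meaningful for such
   g. *)
Definition brauer_character n (rV : mx_representation F (SL2 F) n)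
    (g : {'GL_2[F]}) : R[i] :=
  let chi := char_poly (map_mx j (rV g)) in
  \sum_(a : L | root chi a) iota a *+ mup a chi.

End BrauerCharacter.

(* Main.v *)
(* Let T and T' be the split and nonsplit maximal tori. For t generating a torus
   of order m prime to p, averaging the Brauer character over the torus counts
   the eigenvalues of t equal to 1 on V, so the claim is
   dim V^T = dim V^T' + 2 dim Hom(st, V).

   Since q + 1 = 1 mod p, the functions on P^1(F) split as constants plus st,
   where st consists of the functions of sum zero, and likewise on P^1(L). The
   polynomials of bidegree (q-1, q-1) restricted to the graph of Frobenius are
   the homogeneous polynomials of degree q^2-1, so that st (x) st is, over L, the
   space of functions of sum zero on P^1(L). Hence Fun(P^1(F) x P^1(F)) is
   isomorphic to Fun(P^1(L)) + 2 st. Now P^1(F) x P^1(F) is the disjoint union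
   of P^1(F) and G/T, and P^1(L) that of P^1(F) and G/T'; taking homomorphisms
   to V gives the claim. Dimensions are compared by counting elements of finite
   sets of equivariant functions. *)
Require Import Defs.
From HB Require Import structures.
From mathcomp Require Import all_boot all_order all_algebra all_fingroup.
From mathcomp Require Import all_solvable all_field mxrepresentation.
From mathcomp Require Import reals complex mpoly ring.

Set Implicit Arguments.
Unset Strict Implicit.
Unset Printing Implicit Defensive.

Import Order.TTheory GRing.Theory Num.Theory.
Local Open Scope ring_scope.

(** * Power sums over finite fields *)

(** Since V is arbitrary and nothing is semisimple in characteristic p, comparing composition
    factors would not be enough: the isomorphism must be exhibited. Both directions are integral
    operators whose kernels are built from det(u, w)^(q-1). Power sums over F^2 kill every monomial
    of degree q-1 and, in degree 2(q-1), all but x^(q-1) y^(q-1). Hence the sum over u in F^2 of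
    det(u, w)^(q-1) det(u, w')^(q-1) is det(w, w')^(q-1), even for w and w' over L: the kernel
    reproduces itself, and every composite of operators is computed in closed form. Sums run over
    vectors rather than lines. A line has q-1 nonzero vectors, which is -1 in characteristic p; the
    signs in the kernels come from there. Evaluation at (w, w^q) needs scalars in L, so functions
    take values in L^n, whereas Hom(st, V) lives over F; a function over L is a pair of functions
    over F, and |F|^(2d) = |L|^d. A G-map from the functions on S to V is an equivariant function
    from S to V, so neither duals nor quotients appear, and the common contribution of P^1(F)
    cancels as a factor of two cardinals. *)

Section PowerSums.
Variables (K : finFieldType) (N : nat).
Hypothesis cardK : #|K| = N.+1.

Lemma finField_predC_gt0 : (0 < N)%N.
Proof. by have := finNzRing_gt1 K; rewrite cardK. Qed.

Lemma finField_prim_root : exists z : K, N.-primitive_root z.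
Proof.
have /hasP[z _ pz] : has N.-primitive_root [seq x <- enum K | x != 0].
  apply: has_prim_root; first exact: finField_predC_gt0.
  - apply/allP => x; rewrite mem_filter unity_rootE => /andP[x0 _].
    by apply/eqP; apply: (mulfI x0); rewrite -exprS -cardK expf_card mulr1.
  - exact/filter_uniq/enum_uniq.
  have <- : #|predC1 (0 : K)| = N by rewrite cardC1 cardK.
  rewrite cardE; apply: uniq_leq_size => [|x]; first exact: enum_uniq.
  by rewrite mem_enum mem_filter inE => ->; rewrite mem_enum.
by exists z.
Qed.

Lemma natr_card_finField : N.+1%:R = 0 :> K.
Proof.
by have := expg_cardG (in_setT (1 : K)); rewrite cardsT FinRing.zmodXgE cardK.
Qed.

(** If N divides k > 0, the N nonzero elements contribute 1 each, and N = -1 in K. Otherwise x -> z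
    x, for a generator z, multiplies the sum by z^k, which differs from 1. For k = 0 the convention
    0^0 = 1 makes the sum |K| = 0, hence the condition 0 < k. *)
Lemma sum_expr_finField k :
  \sum_(x : K) x ^+ k = if (0 < k)%N && (N %| k)%N then -1 else 0.
Proof.
case: ifP => [/andP[k0 /dvdnP[m mE]]|nk].
  rewrite (bigD1 0) //= expr0n gtn_eqF // add0r.
  rewrite (eq_bigr (fun=> 1)) => [|x x0]; last first.
    have x1 : x ^+ N = 1 by apply: (mulfI x0); rewrite -exprS -cardK expf_card mulr1.
    by rewrite mE mulnC exprM x1 expr1n.
  rewrite sumr_const cardC1 cardK /=.
  by apply/eqP; rewrite -subr_eq0 opprK -mulrSr natr_card_finField.
case: (posnP k) nk => [-> _|k0 /= nk].
  by rewrite (eq_bigr (fun=> 1)) // sumr_const cardK natr_card_finField.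
have [z pz] := finField_prim_root.
have z0 : z != 0 by rewrite (prim_root_eq0 pz) -lt0n finField_predC_gt0.
have zk : z ^+ k != 1 by rewrite -(prim_order_dvd pz) nk.
have E : z ^+ k * \sum_(x : K) x ^+ k = \sum_(x : K) x ^+ k.
  rewrite [RHS](reindex_inj (mulfI z0)) mulr_sumr.
  by apply: eq_bigr => x _; rewrite exprMn.
apply/eqP; have /eqP : (z ^+ k - 1) * \sum_(x : K) x ^+ k = 0.
  by rewrite mulrBl E mul1r subrr.
by rewrite mulf_eq0 subr_eq0 (negPf zk).
Qed.

Lemma sum_rV2 (V : nmodType) (f : K -> K -> V) :
  \sum_(u : 'rV[K]_2) f (u 0 0) (u 0 1) = \sum_x \sum_y f x y.
Proof.
rewrite pair_bigA /=.
pose h (c : K * K) : 'rV[K]_2 := \row_i (if i == 0 then c.1 else c.2).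
pose g (u : 'rV[K]_2) := (u 0 0, u 0 1).
rewrite (reindex h) /=; first by apply: eq_bigr => c _; rewrite !mxE.
exists g => [c _|u _]; first by rewrite /g !mxE /=; case: c.
apply/rowP => i; rewrite mxE /g /=.
by case: i => -[|[|//]] lti; congr (u _ _); apply: val_inj.
Qed.

Lemma sum_monomial a b :
  (\sum_(u : 'rV[K]_2) u 0 0 ^+ a * u 0 1 ^+ b) =
  (\sum_x x ^+ a) * (\sum_y y ^+ b).
Proof.
rewrite (sum_rV2 (fun x y => x ^+ a * y ^+ b)) mulr_suml.
by apply: eq_bigr => x _; rewrite mulr_sumr.
Qed.

(** A product of two power sums survives only if both exponents are positive multiples of N. This is
    impossible in total degree N, and in total degree 2N it leaves only a = b = N, with value
    (-1)(-1) = 1. *)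
Lemma sum_monomial_N a b : (a + b)%N = N ->
  \sum_(u : 'rV[K]_2) u 0 0 ^+ a * u 0 1 ^+ b = 0.
Proof.
move=> abN; rewrite sum_monomial !sum_expr_finField.
case: ifP => [/andP[a0 Na]|_]; last by rewrite mul0r.
case: ifP => [/andP[b0 Nb]|_]; last by rewrite mulr0.
have := leq_add (dvdn_leq a0 Na) (dvdn_leq b0 Nb).
by rewrite abN -[leqRHS]add0n leq_add2r leqNgt finField_predC_gt0.
Qed.

Lemma sum_monomial_2N a b : (a + b)%N = (N + N)%N ->
  \sum_(u : 'rV[K]_2) u 0 0 ^+ a * u 0 1 ^+ b = (a == N)%:R.
Proof.
move=> abN; rewrite sum_monomial !sum_expr_finField.
case: ifP => [/andP[a0 Na]|na]; last first.
  by rewrite mul0r; case: eqP na => // ->; rewrite finField_predC_gt0 dvdnn.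
case: ifP => [/andP[b0 Nb]|nb]; last first.
  rewrite mulr0; case: eqP abN nb => // -> /addnI->.
  by rewrite finField_predC_gt0 dvdnn.
rewrite mulrNN mulr1.
have leNa := dvdn_leq a0 Na; have leNb := dvdn_leq b0 Nb.
rewrite eqn_leq leNa andbT.
by have := leq_add (leqnn a) leNb; rewrite abN leq_add2r => ->.
Qed.

End PowerSums.

(** * Powers of 2 x 2 determinants with exponent q - 1 *)

Section CharPower.
Variables (R : idomainType) (N : nat).
Hypothesis chN : [pchar R].-nat N.+1.
Hypothesis N_gt0 : (0 < N)%N.

Lemma natr_pchar_nat0 : N.+1%:R = 0 :> R.
Proof.
have pd : pdiv N.+1 \in [pchar R] by apply: (pnatPpi chN); rewrite pi_pdiv.
apply/eqP; rewrite -(dvdn_pcharf pd); exact: pdiv_dvd.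
Qed.

(* Both sides times x - y equal x^(N+1) - y^(N+1). *)
Lemma exprB_geometric (x y : R) :
  (x - y) ^+ N = \sum_(i < N.+1) x ^+ (N - i) * y ^+ i.
Proof.
have [->|xy] := eqVneq x y.
  rewrite subrr expr0n gtn_eqF // (eq_bigr (fun=> y ^+ N)).
    by rewrite sumr_const card_ord -[RHS]mulr_natr natr_pchar_nat0 mulr0.
  by move=> i _; rewrite -exprD subnK // -ltnS.
apply: (mulfI (x := x - y)); first by rewrite subr_eq0.
by rewrite -exprS exprDn_pchar // exprNn_pchar // subrXX.
Qed.

(** The geometric sum is symmetric in x and y, which treats even and odd characteristic alike. *)
Lemma exprBC (x y : R) : (x - y) ^+ N = (y - x) ^+ N.
Proof.
rewrite !exprB_geometric (reindex_inj rev_ord_inj) /=.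
by apply: eq_bigr => i _; rewrite subSS subKn 1?mulrC // -ltnS.
Qed.

Lemma expr_sum_pchar I r (P : pred I) (f : I -> R) :
  (\sum_(i <- r | P i) f i) ^+ N.+1 = \sum_(i <- r | P i) f i ^+ N.+1.
Proof.
by apply: (big_morph (fun x => x ^+ N.+1)); rewrite ?expr0n // => x y; rewrite exprDn_pchar.
Qed.

Definition rdet (u w : 'rV[R]_2) := u 0 0 * w 0 1 - u 0 1 * w 0 0.

Lemma rdet_geometric u w :
  rdet u w ^+ N = \sum_(i < N.+1) w 0 0 ^+ i * w 0 1 ^+ (N - i) *
    (u 0 0 ^+ (N - i) * u 0 1 ^+ i).
Proof.
rewrite /rdet exprB_geometric; apply: eq_bigr => i _.
by rewrite !exprMn mulrACA mulrC [w _ _ ^+ _ * _]mulrC.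
Qed.

Lemma rdetC_exp u w : rdet u w ^+ N = rdet w u ^+ N.
Proof. by rewrite /rdet exprBC [w 0 0 * _]mulrC [w 0 1 * _]mulrC. Qed.

Lemma rdetM_coef (u v : 'rV[R]_2) : exists2 c : nat -> R, c N = rdet u v ^+ N &
  forall w, rdet u w ^+ N * rdet v w ^+ N =
    \sum_(s < (N + N).+1) c s * (w 0 0 ^+ s * w 0 1 ^+ (N + N - s)).
Proof.
pose c s := \sum_(i < N.+1) \sum_(k < N.+1 | (i + k)%N == s)
  (u 0 0 ^+ (N - i) * u 0 1 ^+ i) * (v 0 0 ^+ (N - k) * v 0 1 ^+ k).
exists c => [|w].
  rewrite /c /rdet exprB_geometric; apply: eq_bigr => i _.
  rewrite (bigD1 (rev_ord i)) /=; last by rewrite subSS subnKC // -ltnS.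
  rewrite big1 ?addr0 => [|k /andP[/eqP ik kr]].
    rewrite subSS subKn -1?ltnS // !exprMn.
    by rewrite [v 0 0 ^+ _ * _]mulrC mulrACA.
  by case/eqP: kr; apply: val_inj; apply/eqP;
     rewrite /= subSS -(eqn_add2l i) ik subnKC // -ltnS.
rewrite !rdet_geometric mulr_suml /c.
under [RHS]eq_bigr => s _ do rewrite mulr_suml.
rewrite exchange_big /=; apply: eq_bigr => i _.
rewrite mulr_sumr; under [RHS]eq_bigr => s _ do rewrite mulr_suml.
rewrite (exchange_big_dep predT) //=; apply: eq_bigr => k _.
have lt : (i + k < (N + N).+1)%N by rewrite ltnS leq_add // -ltnS.
rewrite (big_pred1 (Ordinal lt)) => [|s]; last by rewrite eq_sym.
rewrite /= (mulrACA (_ ^+ _ * _ ^+ _)) (mulrACA (w 0 0 ^+ i)) -!exprD mulrC.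
congr (_ * (_ * _ ^+ _)); apply/eqP.
by rewrite -(eqn_add2r (i + k)) addnACA !subnK // -ltnS.
Qed.

End CharPower.

(** * Convolution identities for powers of determinants *)

Section Convolution.
Variables (F L : finFieldType) (j : {rmorphism F -> L}) (N : nat).
Hypothesis cardF : #|F| = N.+1.
Hypothesis cardL : #|L| = (N.+1 ^ 2)%N.
Hypothesis chL : [pchar L].-nat N.+1.

Let N_gt0 : (0 < N)%N := finField_predC_gt0 cardF.
Let cardL' : #|L| = (N + N.+1 * N).+1.
Proof. by rewrite cardL expnS expn1 mulnSr addnC mulnC. Qed.

Lemma sum_monomial_map a b :
  \sum_(u : 'rV[F]_2) (map_mx j u 0 0 ^+ a * map_mx j u 0 1 ^+ b) =
  j (\sum_(u : 'rV[F]_2) u 0 0 ^+ a * u 0 1 ^+ b).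
Proof. by rewrite rmorph_sum; apply: eq_bigr => u _; rewrite !mxE rmorphM !rmorphXn. Qed.

Lemma sum_rdet (w : 'rV[L]_2) :
  \sum_(u : 'rV[F]_2) rdet (map_mx j u) w ^+ N = 0.
Proof.
under eq_bigr => u _ do rewrite rdet_geometric //.
rewrite exchange_big /= big1 // => i _; rewrite -mulr_sumr sum_monomial_map.
by rewrite (sum_monomial_N cardF) ?rmorph0 ?mulr0 // subnK // -ltnS.
Qed.

(** In u the summand has degree 2N, so the sum extracts the coefficient of u_0^N u_1^N. Although u
    only ranges over F^2, the identity holds for all w and w' over L. *)
Lemma sum_rdetM (w w' : 'rV[L]_2) :
  \sum_(u : 'rV[F]_2) rdet (map_mx j u) w ^+ N * rdet (map_mx j u) w' ^+ N =
  rdet w w' ^+ N.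
Proof.
have [c cN cE] := rdetM_coef chL N_gt0 w w'.
under eq_bigr => u _ do
  rewrite (rdetC_exp chL N_gt0 _ w) (rdetC_exp chL N_gt0 _ w') cE.
rewrite exchange_big /= -cN.
have lt : (N < (N + N).+1)%N by rewrite ltnS leq_addr.
rewrite (bigD1 (Ordinal lt)) //= [X in _ + X]big1 ?addr0 => [|s sN].
  rewrite -mulr_sumr sum_monomial_map (sum_monomial_2N cardF) ?eqxx ?rmorph1 ?mulr1 //.
  by rewrite addnK.
rewrite -mulr_sumr sum_monomial_map (sum_monomial_2N cardF); last first.
  by rewrite subnKC // -ltnS.
by rewrite -val_eqE /= in sN; rewrite (negPf sN) rmorph0 mulr0.
Qed.

(** The summand has degree N + (N+1)N = |L| - 1 in w, too small for a power sum over L^2 to be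
    nonzero. *)
Lemma sum_rdet_twist (u v : 'rV[L]_2) :
  \sum_(w : 'rV[L]_2) rdet u w ^+ N * (rdet v w ^+ N) ^+ N.+1 = 0.
Proof.
under eq_bigr => w _ do
  rewrite (rdet_geometric chL) // [rdet v w ^+ N](rdet_geometric chL) //
          expr_sum_pchar // mulr_suml.
rewrite exchange_big /= big1 // => i _.
under eq_bigr => w _ do rewrite mulr_sumr.
rewrite exchange_big /= big1 // => k _.
under eq_bigr => w _ do
  rewrite !exprMn -!exprM (mulrACA (_ ^+ _ * _ ^+ _))
      (mulrACA (w 0 0 ^+ i) (w 0 1 ^+ _) (w 0 0 ^+ _)) -!exprD.
rewrite -mulr_suml (sum_monomial_N cardL') ?mul0r //.
have iN : (i <= N)%N by rewrite -ltnS.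
have kN : (k <= N)%N by rewrite -ltnS.
by rewrite addnACA subnKC // -mulnDl subnKC // mulnC.
Qed.

(** The summand has degree 2(q^2-1) in w, with monomials whose first exponent is s + q t for s, t <=
    2(q-1). Only the exponent q^2-1 = (q-1) + q(q-1) survives, and it forces s = t = q-1, so each
    factor contributes its middle coefficient. *)
Lemma sum_rdetM_twist (u u' v v' : 'rV[L]_2) :
  \sum_(w : 'rV[L]_2) (rdet u w ^+ N * (rdet v w ^+ N) ^+ N.+1) *
     (rdet u' w ^+ N * (rdet v' w ^+ N) ^+ N.+1) =
  rdet u u' ^+ N * (rdet v v' ^+ N) ^+ N.+1.
Proof.
have [c cN cE] := rdetM_coef chL N_gt0 u u'.
have [d dN dE] := rdetM_coef chL N_gt0 v v'.
under eq_bigr => w _ do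
  rewrite mulrACA -[X in _ * X]exprMn cE dE expr_sum_pchar // mulr_suml.
rewrite exchange_big /= -cN -dN.
have lt : (N < (N + N).+1)%N by rewrite ltnS leq_addr.
have E (s t : 'I_(N + N).+1) :
  \sum_(w : 'rV[L]_2) c s * (w 0 0 ^+ s * w 0 1 ^+ (N + N - s)) *
     (d t * (w 0 0 ^+ t * w 0 1 ^+ (N + N - t))) ^+ N.+1 =
  c s * d t ^+ N.+1 * ((s == N :> nat) && (t == N :> nat))%:R.
  under eq_bigr => w _ do
    rewrite !exprMn -!exprM mulrACA [X in _ * X]mulrACA -!exprD.
  have sN : (s <= N + N)%N by rewrite -ltnS.
  have tN : (t <= N + N)%N by rewrite -ltnS.
  rewrite -mulr_sumr (sum_monomial_2N cardL'); last first.
    rewrite addnACA subnKC // -mulnDl subnKC // addnACA; congr (_ + _)%N.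
    by rewrite mulnC -mulnDr.
  congr (_ * (nat_of_bool _)%:R).
  apply/eqP/andP => [st|[/eqP-> /eqP->]]; last by rewrite mulnC.
  (* Here x may exceed N, so it need not be a base q digit; but x = N modulo N+1 together with x <=
     2N < N + (N+1) still gives x = N. *)
  have digits (x y x' y' : nat) : (x <= N + N)%N -> x' = N ->
    (x + N.+1 * y = x' + N.+1 * y')%N -> x = x' /\ y = y'.
    move=> xN -> E; suff xE : x = N.
      by move: E; rewrite xE => /addnI/eqP; rewrite eqn_pmul2l // => /eqP.
    have : (x = N %[mod N.+1])%N by rewrite -[LHS](modnMDl y) mulnC addnC E addnC mulnC modnMDl.
    rewrite [RHS]modn_small //; have [ltx|lex] := ltnP x N.+1; first by rewrite modn_small.
    rewrite -(subnK lex) modnDr modn_small; last first.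
      by rewrite ltnS leq_subLR (leq_trans xN) // leq_add2r.
    by move=> xE; move: xN; rewrite -(subnK lex) xE leq_add2l ltnn.
  have [|||-> ->//] := digits s t N N; rewrite // [(N.+1 * t)%N]mulnC st //.
under eq_bigr => s _.
  under eq_bigr => w _ do rewrite mulr_sumr.
  rewrite exchange_big /=; under eq_bigr => t _ do rewrite E.
  over.
rewrite (bigD1 (Ordinal lt)) //= (bigD1 (Ordinal lt)) //= !eqxx mulr1.
rewrite big1 => [|t /negPf tN]; last by rewrite -[t == N :> nat]/(t == Ordinal lt) tN mulr0.
rewrite addr0 big1 ?addr0 // => s /negPf sN; apply: big1 => t _.
by rewrite -[s == N :> nat]/(s == Ordinal lt) sN mulr0.
Qed.

End Convolution.

(** * Equivariant functions *)

Section EquivariantFunctions.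
Variables (gT : finGroupType) (G : {group gT}).

(* Points are classes for gsim inside gdom; in the instances below these are
   nonzero vectors up to scaling, so that no quotient is needed. *)
Structure gset := GSet {
  gset_sort :> finType;
  gact : gset_sort -> gT -> gset_sort;
  gsim : rel gset_sort;
  gdom : pred gset_sort;
  gact1 : forall s, gact s 1%g = s;
  gactM : forall s g h, gact s (g * h)%g = gact (gact s g) h;
  gsim_refl : reflexive gsim;
  gsim_sym : ssrbool.symmetric gsim;
  gsim_trans : transitive gsim;
  gsim_act : forall s t g, gsim s t -> gsim (gact s g) (gact t g);
  gsim_dom : forall s t, gsim s t -> gdom s = gdom t;
  gdom_act : forall s g, gdom (gact s g) = gdom s
}.

Variables (K : finFieldType) (n : nat) (r : mx_representation K G n).

(** The G-maps from functions on the points of S to V, each given by its values on point masses.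
    Points carry a right action and V a left one, hence the inverse. The value 0 outside of [gdom]
    makes such a function determined by its values on points. *)
Definition equivariant (S : gset) : {set {ffun S -> 'cV[K]_n}} :=
  [set f : {ffun S -> 'cV[K]_n} | [&& [forall s, ~~ gdom s ==> (f s == 0)],
    [forall s, forall t, gsim s t ==> (f s == f t)] &
    [forall g in G, forall s, f (gact s g) == r g^-1%g *m f s]]].

Lemma equivariantP (S : gset) (f : {ffun S -> 'cV[K]_n}) :
  reflect [/\ forall s, ~~ gdom s -> f s = 0,
              forall s t, gsim s t -> f s = f t &
              forall g s, g \in G -> f (gact s g) = r g^-1%g *m f s]
          (f \in equivariant S).
Proof.
rewrite inE; apply: (iffP and3P) => [[/forallP h0 /forallP hs /forall_inP hg]|[h0 hs hg]].
  split=> [s sd|s t st|g s gG].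
  - by have := h0 s; rewrite sd => /eqP.
  - by have /forallP/(_ t) := hs s; rewrite st => /eqP.
  by have /forallP/(_ s)/eqP := hg g gG.
split.
- by apply/forallP => s; apply/implyP => /h0/eqP.
- by apply/forallP => s; apply/forallP => t; apply/implyP => /hs/eqP.
by apply/forall_inP => g gG; apply/forallP => s; apply/eqP/hg.
Qed.

Definition stab_fix (S : gset) (s0 : S) : {set 'cV[K]_n} :=
  [set x | [forall g in G, gsim (gact s0 g) s0 ==> (r g *m x == x)]].

Lemma stab_fixP (S : gset) (s0 : S) x :
  reflect (forall g, g \in G -> gsim (gact s0 g) s0 -> r g *m x = x)
          (x \in stab_fix s0).
Proof.
rewrite inE; apply: (iffP forall_inP) => h g gG.
  by have := h g gG => /implyP h' /h'/eqP.
by apply/implyP => /(h g gG)/eqP.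
Qed.

Lemma repr_col_Vx m g (u : 'M_(n, m)) : g \in G -> r g^-1%g *m (r g *m u) = u.
Proof. by move=> gG; rewrite mulmxA -repr_mxM ?groupV // mulVg repr_mx1 mul1mx. Qed.

(** The points of S are those of S1 together with the orbit of s0. By Frobenius reciprocity on the
    orbit, an equivariant function amounts to its restriction to S1 and its value at s0, which can
    be any vector fixed by the stabiliser of the class of s0. *)
Lemma card_equivariant_orbit (S1 S : gset) (i : S1 -> S) (s0 : S) :
  (forall s g, i (gact s g) = gact (i s) g) ->
  (forall s, gdom (i s) = gdom s) ->
  (forall s t, gsim (i s) (i t) = gsim s t) ->
  gdom s0 ->
  (forall s, gdom s -> (exists s1, gsim (i s1) s) \/
                       (exists2 g, g \in G & gsim (gact s0 g) s)) ->
  (forall s1 g, g \in G -> ~~ gsim (i s1) (gact s0 g)) ->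
  #|equivariant S| = (#|equivariant S1| * #|stab_fix s0|)%N.
Proof.
move=> iact idom isim s0d cover disj.
pose res (f : {ffun S -> 'cV[K]_n}) : {ffun S1 -> 'cV[K]_n} * 'cV[K]_n :=
  ([ffun s => f (i s)], f s0).
have res_inj : {in equivariant S &, injective res}.
  move=> f h /equivariantP[f0 fs fg] /equivariantP[h0 hs hg] [/ffunP fhi fh0].
  apply/ffunP => s; have [sd|sd] := boolP (gdom s); last by rewrite f0 ?h0.
  have [[s1 ss]|[g gG ss]] := cover s sd.
    by rewrite -(fs _ _ ss) -(hs _ _ ss); have := fhi s1; rewrite !ffunE.
  by rewrite -(fs _ _ ss) -(hs _ _ ss) fg // hg // fh0.
rewrite -cardsX -(card_in_imset res_inj); apply: eq_card => -[a x].
rewrite in_setX /=; apply/imsetP/andP => [[f /equivariantP[f0 fs fg] [-> ->]]|].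
  split.
    apply/equivariantP; split=> [s sd|s t st|g s gG]; rewrite !ffunE.
    - by rewrite f0 // idom.
    - by apply: fs; rewrite isim.
    by rewrite iact fg.
  apply/stab_fixP => g gG ss; rewrite -{1}(fs _ _ ss) fg //.
  by rewrite -{1}[g]invgK repr_col_Vx ?groupV.
case=> /equivariantP[a0 ak ag] /stab_fixP xfix.
(* The extension of the pair (a, x); [fi] and [f0] show that its values do not depend on the picked
   elements. *)
pose f := [ffun s => if [pick s1 | gsim (i s1) s] is Some s1 then a s1 else
  if [pick g | (g \in G) && gsim (gact s0 g) s] is Some g then r g^-1%g *m x else 0].
have fi s1 s : gsim (i s1) s -> f s = a s1.
  move=> ss; rewrite ffunE; case: pickP => [s2 ss2|/(_ s1)]; last by rewrite ss.
  by apply: ak; rewrite -isim; apply: gsim_trans ss2 _; rewrite gsim_sym.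
have f0 g s : g \in G -> gsim (gact s0 g) s -> f s = r g^-1%g *m x.
  move=> gG ss; rewrite ffunE; case: pickP => [s2 ss2|_].
    by case/negP: (disj s2 g gG); apply: gsim_trans ss2 _; rewrite gsim_sym.
  case: pickP => [h /andP[hG hs]|/(_ g)]; last by rewrite gG ss.
  have gh : gsim (gact s0 g) (gact s0 h) by apply: gsim_trans ss _; rewrite gsim_sym.
  have /(gsim_act h^-1%g) := gh; rewrite -!gactM mulgV gact1 => gh'.
  have gh'G : (g * h^-1)%g \in G by rewrite groupM ?groupV.
  by rewrite -[in RHS](xfix _ gh'G gh') mulmxA -repr_mxM ?groupV // mulgA mulVg mul1g.
exists f; last first.
  congr (_, _); last by rewrite (f0 1%g) ?gact1 ?gsim_refl // invg1 repr_mx1 mul1mx.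
  by apply/ffunP => s; rewrite ffunE (fi s) // gsim_refl.
have f00 s : ~~ gdom s -> f s = 0.
  move=> sd; rewrite ffunE; case: pickP => [s1 ss|_].
    by apply: a0; rewrite -idom (gsim_dom ss).
  case: pickP => // g /andP[_ ss].
  by case/negP: sd; rewrite -(gsim_dom ss) gdom_act.
apply/equivariantP; split=> //.
  move=> s t st; have [sd|sd] := boolP (gdom s); last first.
    by rewrite !f00 // -(gsim_dom st).
  have [[s1 ss]|[g gG ss]] := cover s sd.
    by rewrite (fi _ _ ss) (fi _ _ (gsim_trans ss st)).
  by rewrite (f0 _ _ gG ss) (f0 _ _ gG (gsim_trans ss st)).
move=> g s gG; have [sd|sd] := boolP (gdom s); last first.
  by rewrite !f00 ?gdom_act ?mulmx0.
have [[s1 ss]|[h hG ss]] := cover s sd.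
  by rewrite (fi _ _ ss) -ag // (fi (gact s1 g)) // iact gsim_act.
rewrite (f0 _ _ hG ss) (f0 (h * g)%g) ?groupM //; last by rewrite gactM gsim_act.
by rewrite invMg repr_mxM ?groupV // mulmxA.
Qed.

End EquivariantFunctions.

Section Lines.
Variables (F K : finFieldType) (j : {rmorphism F -> K}).
Local Notation G := (SL2_group F).

Definition vact (u : 'rV[K]_2) (g : {'GL_2[F]}) := u *m map_mx j (GLval g).
Definition vsim : rel 'rV[K]_2 := fun u v => [exists a : K, (a != 0) && (v == a *: u)].

Lemma vsimP u v : reflect (exists2 a, a != 0 & v = a *: u) (vsim u v).
Proof.
apply: (iffP existsP) => [[a /andP[a0 /eqP->]]|[a a0 ->]]; first by exists a.
by exists a; rewrite a0 eqxx.
Qed.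

Lemma vact1 u : vact u 1%g = u.
Proof. by rewrite /vact GL_1E map_mx1 mulmx1. Qed.

Lemma vactM u g h : vact u (g * h)%g = vact (vact u g) h.
Proof. by rewrite /vact GL_MxE map_mxM mulmxA. Qed.

Lemma vactZ a u g : vact (a *: u) g = a *: vact u g.
Proof. by rewrite /vact scalemxAl. Qed.

Lemma vsim_refl : reflexive vsim.
Proof. by move=> u; apply/vsimP; exists 1; rewrite ?oner_neq0 ?scale1r. Qed.

Lemma vsim_sym : ssrbool.symmetric vsim.
Proof.
suff h u v : vsim u v -> vsim v u by move=> u v; apply/idP/idP => /h.
case/vsimP=> a a0 ->; apply/vsimP; exists a^-1; first by rewrite invr_eq0.
by rewrite scalerA mulVf // scale1r.
Qed.

Lemma vsim_trans : transitive vsim.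
Proof.
move=> v u w /vsimP[a a0 ->] /vsimP[b b0 ->]; apply/vsimP; exists (b * a).
  by rewrite mulf_neq0.
by rewrite scalerA.
Qed.

Lemma vsim_act u v g : vsim u v -> vsim (vact u g) (vact v g).
Proof. by case/vsimP=> a a0 ->; apply/vsimP; exists a; rewrite ?vactZ. Qed.

Lemma vsim_dom u v : vsim u v -> (u != 0) = (v != 0).
Proof. by case/vsimP=> a a0 ->; rewrite scaler_eq0 (negPf a0). Qed.

Lemma vdom_act u g : (vact u g != 0) = (u != 0).
Proof.
congr (~~ _); apply/eqP/eqP => [ug|->]; last by rewrite /vact mul0mx.
by rewrite -[u]vact1 -(mulgV g) vactM ug /vact mul0mx.
Qed.

Definition lines := GSet vact1 vactM vsim_refl vsim_sym vsim_trans vsim_act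
  vsim_dom vdom_act.

End Lines.

Section Pairs.
Variables (gT : finGroupType) (S T : gset gT).

Definition pact (c : S * T) g := (gact c.1 g, gact c.2 g).
Definition psim : rel (S * T) := fun c d => gsim c.1 d.1 && gsim c.2 d.2.
Definition pdom : pred (S * T) := fun c => gdom c.1 && gdom c.2.

Lemma pact1 c : pact c 1%g = c.
Proof. by case: c => s t; rewrite /pact !gact1. Qed.

Lemma pactM c g h : pact c (g * h)%g = pact (pact c g) h.
Proof. by rewrite /pact !gactM. Qed.

Lemma psim_refl : reflexive psim.
Proof. by move=> c; rewrite /psim !gsim_refl. Qed.

Lemma psim_sym : ssrbool.symmetric psim.
Proof. by move=> c d; rewrite /psim gsim_sym [gsim c.2 _]gsim_sym. Qed.

Lemma psim_trans : transitive psim.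
Proof.
move=> c b d /andP[h1 h2] /andP[h3 h4].
by rewrite /psim (gsim_trans h1 h3) (gsim_trans h2 h4).
Qed.

Lemma psim_act c d g : psim c d -> psim (pact c g) (pact d g).
Proof. by case/andP=> h1 h2; rewrite /psim !gsim_act. Qed.

Lemma psim_dom c d : psim c d -> pdom c = pdom d.
Proof. by case/andP=> h1 h2; rewrite /pdom (gsim_dom h1) (gsim_dom h2). Qed.

Lemma pdom_act c g : pdom (pact c g) = pdom c.
Proof. by rewrite /pdom !gdom_act. Qed.

Definition pairs := GSet pact1 pactM psim_refl psim_sym psim_trans psim_act
  psim_dom pdom_act.

End Pairs.

(** * Lines of the plane *)

Section PlaneGeometry.
Variable K : fieldType.
Implicit Types u v : 'rV[K]_2.

Lemma rV2P u v : u 0 0 = v 0 0 -> u 0 1 = v 0 1 -> u = v.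
Proof.
move=> e0 e1; apply/rowP => -[[|[|//]] lti].
  by have -> : Ordinal lti = 0 by apply: val_inj.
by have -> : Ordinal lti = 1 by apply: val_inj.
Qed.

Lemma mulmx_rV2 u (h : 'M[K]_2) i : (u *m h) 0 i = u 0 0 * h 0 i + u 0 1 * h 1 i.
Proof.
rewrite mxE !big_ord_recl big_ord0 addr0.
by congr (_ + u _ _ * h _ _); apply: val_inj.
Qed.

Lemma det_mx22 (h : 'M[K]_2) : \det h = h 0 0 * h 1 1 - h 0 1 * h 1 0.
Proof.
rewrite (expand_det_row _ 0) !big_ord_recl big_ord0 /cofactor !det_mx11 !mxE /=.
rewrite expr0 mul1r expr1 mulN1r addr0 mulrN.
by congr (h _ _ * h _ _ - h _ _ * h _ _); apply: val_inj.
Qed.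

Lemma rdetM u v (h : 'M[K]_2) : rdet (u *m h) (v *m h) = \det h * rdet u v.
Proof. by rewrite /rdet !mulmx_rV2 det_mx22; ring. Qed.

Lemma rdetZl a u v : rdet (a *: u) v = a * rdet u v.
Proof. by rewrite /rdet !mxE; ring. Qed.

Lemma rdetZr a u v : rdet u (a *: v) = a * rdet u v.
Proof. by rewrite /rdet !mxE; ring. Qed.

Lemma rdet0l v : rdet 0 v = 0.
Proof. by rewrite /rdet !mxE !mul0r subrr. Qed.

Lemma rdet0r v : rdet v 0 = 0.
Proof. by rewrite /rdet !mxE !mulr0 subrr. Qed.

Lemma rdet_eq0P u v : u != 0 -> rdet u v = 0 -> exists a, v = a *: u.
Proof.
move=> u0 /eqP; rewrite subr_eq0 => /eqP uv.
have [u00|u00] := eqVneq (u 0 0) 0; last first.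
  exists (v 0 0 / u 0 0); apply: rV2P; rewrite mxE; first by rewrite divfK.
  by apply: (mulfI u00); rewrite uv mulrA [u 0 0 * (_ / _)]mulrC divfK // mulrC.
have u01 : u 0 1 != 0.
  by apply: contraNneq u0 => u01; apply/eqP/rV2P; rewrite mxE.
exists (v 0 1 / u 0 1); apply: rV2P; rewrite mxE; last by rewrite divfK.
by rewrite u00 mulr0; apply: (mulfI u01); rewrite -uv u00 mul0r mulr0.
Qed.

End PlaneGeometry.

Lemma rdet_map (K K' : fieldType) (f : {rmorphism K -> K'}) u v :
  rdet (map_mx f u) (map_mx f v) = f (rdet u v).
Proof. by rewrite /rdet !mxE rmorphB !rmorphM. Qed.

(** * Orbits of SL_2(F) on pairs of lines over F and on lines over L *)

Section SL2Geometry.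
Variables (F : finFieldType).

Lemma SL2_of_mx (h : 'M[F]_2) : \det h = 1 -> exists2 g, g \in SL2 F & GLval g = h.
Proof.
move=> h1; have hU : h \is a GRing.unit.
  by have /= := unitmxE h; rewrite h1 unitr1.
by exists (FinRing.Unit hU); rewrite ?inE //= h1.
Qed.

Lemma SL2_det g : g \in SL2 F -> \det (GLval g) = 1.
Proof. by rewrite inE => /eqP. Qed.

Lemma vsimE (K : finFieldType) (u v : 'rV[K]_2) :
  vsim u v = (rdet u v == 0) && ((u == 0) == (v == 0)).
Proof.
apply/vsimP/andP => [[a a0 ->]|[/eqP uv /eqP uv0]].
  by rewrite rdetZr /rdet [u 0 0 * _]mulrC subrr mulr0 scaler_eq0 (negPf a0).
have [u0|u0] := eqVneq u 0.
  exists 1; first exact: oner_neq0.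
  by apply/eqP; rewrite u0 scaler0 -uv0 u0.
have [a va] := rdet_eq0P u0 uv; exists a => //.
by apply: contraNneq u0 => a0; rewrite uv0 va a0 scale0r.
Qed.

Lemma rdet_vact (K : finFieldType) (j : {rmorphism F -> K}) (u v : 'rV[K]_2) g :
  g \in SL2 F -> rdet (vact j u g) (vact j v g) = rdet u v.
Proof. by move=> gG; rewrite rdetM det_map_mx SL2_det // rmorph1 mul1r. Qed.

Definition projline : gset {'GL_2[F]} := lines (idfun : {rmorphism F -> F}).

Lemma vact_map (K : finFieldType) (j : {rmorphism F -> K}) (u : 'rV[F]_2) g :
  map_mx j (vact (idfun : {rmorphism F -> F}) u g) = vact j (map_mx j u) g.
Proof. by rewrite /vact map_mxM; congr (_ *m map_mx _ _); apply/matrixP => k l; rewrite mxE. Qed.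

Definition row2 (a b : F) : 'rV[F]_2 := \row_i (if i == 0 then a else b).

Lemma row2_neq0 a b : (a != 0) || (b != 0) -> row2 a b != 0.
Proof.
apply: contraTN => /eqP/rowP h; have := h 0; have := h 1; rewrite !mxE /= => -> ->.
by rewrite eqxx.
Qed.

Lemma row2M a b (h : 'M[F]_2) : row2 a b *m h = a *: row 0 h + b *: row 1 h.
Proof. by apply/rowP => i; rewrite mulmx_rV2 !mxE. Qed.

Definition axes : pairs projline projline := (row2 1 0, row2 0 1).

Lemma axes_transitive (u v : 'rV[F]_2) : rdet u v != 0 ->
  exists2 g, g \in SL2 F & gsim (gact axes g) ((u, v) : pairs projline projline).
Proof.
(* Rescaling v keeps its line and makes the matrix with rows u and w of determinant 1; this matrix
   carries the axes to the lines of u and v. *)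
move=> d0; pose w := (rdet u v)^-1 *: v.
pose h : 'M[F]_2 := \matrix_(i, k) (if i == 0 then u 0 k else w 0 k).
have h1 : \det h = 1.
  rewrite det_mx22 !mxE /= -[RHS](mulVf d0) -rdetZr.
  by rewrite /rdet !mxE.
have [g gG gh] := SL2_of_mx h1; exists g => //.
have E (x : 'rV[F]_2) : gact (x : projline) g = x *m h.
  by rewrite /= /vact gh; congr (_ *m _); apply/matrixP => k l; rewrite mxE.
rewrite /= /psim /axes /pact !E !row2M !scale1r !scale0r addr0 add0r.
have -> : row 0 h = u by apply/rowP => i; rewrite !mxE.
have -> : row 1 h = w by apply/rowP => i; rewrite !mxE.
rewrite gsim_refl /=; apply/vsimP; exists (rdet u v) => //.
by rewrite scalerA divff // scale1r.
Qed.

Lemma card_equivariant_pairs (K : finFieldType) n (r : mx_representation K (SL2_group F) n) :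
  #|equivariant r (pairs projline projline)| =
  (#|equivariant r projline| * #|stab_fix r axes|)%N.
Proof.
apply: (@card_equivariant_orbit _ _ _ _ r projline (pairs projline projline)
  (fun u => (u, u)) axes) => //.
- by move=> s; rewrite /= /pdom andbb.
- by move=> s t; rewrite /= /psim andbb.
- by rewrite /= /pdom /= !row2_neq0 ?oner_neq0 ?orbT.
- case=> u v /andP[/= u0 v0]; have [uv|uv] := eqVneq (rdet u v) 0.
    left; exists u; rewrite /= /psim /= vsim_refl /=.
    by rewrite vsimE uv eqxx (negPf u0) (negPf v0).
  by right; have [g gG gs] := axes_transitive uv; exists g.
move=> u g gG; apply/negP => /andP[/= h1 h2].
have := vsim_trans (etrans (vsim_sym _ _) h1) h2.
rewrite vsimE rdet_vact // /rdet !mxE /= mulr1 mulr0 subr0 oner_eq0 //.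
Qed.

Variables (L : finFieldType) (j : {rmorphism F -> L}) (N : nat).
Hypothesis cardF : #|F| = N.+1.
Hypothesis cardL : #|L| = (N.+1 ^ 2)%N.
Hypothesis chL : [pchar L].-nat N.+1.

Let frobE x : (x ^+ N.+1) ^+ N.+1 = x :> L.
Proof. by rewrite -exprM -[in RHS](expf_card x) cardL expnS expn1. Qed.

Let frobj a : j a ^+ N.+1 = j a.
Proof. by rewrite -rmorphXn -cardF expf_card. Qed.

Let frobD (x y : L) : (x + y) ^+ N.+1 = x ^+ N.+1 + y ^+ N.+1.
Proof. exact: exprDn_pchar. Qed.

Let frobB (x y : L) : (x - y) ^+ N.+1 = x ^+ N.+1 - y ^+ N.+1.
Proof. by rewrite frobD exprNn_pchar. Qed.

(* delta w is the determinant of w and its Frobenius conjugate; it vanishes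
   exactly on the multiples of vectors over F. *)
Definition delta (w : 'rV[L]_2) := w 0 0 * w 0 1 ^+ N.+1 - w 0 1 * w 0 0 ^+ N.+1.

Lemma deltaM w (h : 'M[F]_2) : delta (w *m map_mx j h) = j (\det h) * delta w.
Proof.
rewrite /delta !mulmx_rV2 !mxE !frobD !exprMn !frobj det_mx22 rmorphB !rmorphM.
by ring.
Qed.

Lemma deltaZ a w : delta (a *: w) = a ^+ N.+2 * delta w.
Proof. by rewrite /delta !mxE !exprMn [a ^+ N.+2]exprS; ring. Qed.

Lemma delta_map (u : 'rV[F]_2) : delta (map_mx j u) = 0.
Proof. by rewrite /delta !mxE !frobj mulrC subrr. Qed.

(** Consequently the quotient of two values of [delta] is fixed by Frobenius, as [norm_surj]
    requires. *)
Lemma delta_frob w : delta w ^+ N.+1 = - delta w.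
Proof. by rewrite /delta frobB !exprMn !frobE; ring. Qed.

Lemma delta_eq0 w : w != 0 -> delta w = 0 -> exists u : 'rV[F]_2, vsim (map_mx j u) w.
Proof.
move=> w0 /eqP; rewrite subr_eq0 => /eqP dw.
have [w00|w00] := eqVneq (w 0 0) 0.
  exists (row2 0 1); have w01 : w 0 1 != 0.
    by apply: contraNneq w0 => w01; apply/eqP/rV2P; rewrite mxE.
  apply/vsimP; exists (w 0 1) => //; apply: rV2P; rewrite !mxE /=.
    by rewrite rmorph0 mulr0.
  by rewrite rmorph1 mulr1.
pose x := w 0 1 / w 0 0.
have xq : x ^+ #|F| = x.
  rewrite cardF /x exprMn exprVn; apply: (mulIf (expf_neq0 N.+1 w00)).
  rewrite divfK ?expf_neq0 //; apply: (mulfI w00).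
  by rewrite dw mulrA mulrCA divff ?mulr1.
exists (row2 1 (descend j x)); apply/vsimP; exists (w 0 0) => //.
apply: rV2P; rewrite !mxE /=; first by rewrite rmorph1 mulr1.
by rewrite fixed_descend // mulrC divfK.
Qed.

(** Surjectivity of the norm a -> a^(q+1) onto the nonzero elements of F: if c = z^k for a generator
    z of order (q+1)(q-1), then c^(q-1) = 1 forces q+1 to divide k. *)
Lemma norm_surj (c : L) : c != 0 -> c ^+ N.+1 = c -> exists2 a, a != 0 & a ^+ N.+2 = c.
Proof.
move=> c0 cq.
have cardL' : #|L| = (N.+2 * N).+1.
  by rewrite cardL expnS expn1 !mulSn mulnS addSn addnA [(N + _ + _)%N]addnC.
have [z pz] := finField_prim_root cardL'.
have z0 : z != 0.
  rewrite (prim_root_eq0 pz) -lt0n muln_gt0 /=; exact: finField_predC_gt0 cardF.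
have cM : c ^+ (N.+2 * N) = 1.
  by apply: (mulfI c0); rewrite -exprS -cardL' expf_card mulr1.
have [k ck] := prim_rootP pz cM.
have cN : c ^+ N = 1 by apply: (mulfI c0); rewrite -exprS cq mulr1.
have : (N.+2 * N %| k * N)%N.
  by rewrite (prim_order_dvd pz) exprM -ck cN.
rewrite dvdn_pmul2r ?(finField_predC_gt0 cardF) // => /dvdnP[m km].
exists (z ^+ m); first exact: expf_neq0.
by rewrite -exprM -km.
Qed.

(** The coordinates of w0 are independent over F, hence form a basis of L by cardinality. *)
Lemma nonrational_basis w0 : delta w0 != 0 ->
  forall x : L, exists a b, x = w0 0 0 * j a + w0 0 1 * j b.
Proof.
move=> d0; pose f (c : F * F) := w0 0 0 * j c.1 + w0 0 1 * j c.2.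
have f_inj : injective f.
  move=> [a b] [a' b'] /eqP; rewrite /f /= -subr_eq0 opprD addrACA -!mulrBr -!rmorphB.
  move: (a - a') (b - b') (subr_eq0 a a') (subr_eq0 b b') => x y xE yE /eqP e.
  (* Frobenius gives a second linear equation in (x, y); the determinant of the system is
     [delta w0]. *)
  have e' : w0 0 0 ^+ N.+1 * j x + w0 0 1 ^+ N.+1 * j y = 0.
    by rewrite -[j x]frobj -[j y]frobj -!exprMn -frobD e expr0n.
  have jx : j x * delta w0 = 0.
    have -> : j x * delta w0 = w0 0 1 ^+ N.+1 * (w0 0 0 * j x + w0 0 1 * j y) -
       w0 0 1 * (w0 0 0 ^+ N.+1 * j x + w0 0 1 ^+ N.+1 * j y) by rewrite /delta; ring.
    by rewrite e e' !mulr0 subrr.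
  have jy : j y * delta w0 = 0.
    have -> : j y * delta w0 = w0 0 0 * (w0 0 0 ^+ N.+1 * j x + w0 0 1 ^+ N.+1 * j y)
       - w0 0 0 ^+ N.+1 * (w0 0 0 * j x + w0 0 1 * j y) by rewrite /delta; ring.
    by rewrite e e' !mulr0 subrr.
  move/eqP: jx; move/eqP: jy; rewrite !mulf_eq0 (negPf d0) !orbF !fmorph_eq0 xE yE.
  by move=> /eqP-> /eqP->.
have cFF : (#|L| <= #|{: F * F}|)%N by rewrite card_prod cardL cardF expnS expn1.
move=> x; have /codomP[[a b] ->] := inj_card_onto f_inj cFF x.
by exists a, b.
Qed.

(** Expanding the coordinates of a w in the basis given by w0 yields a matrix over F sending w0 to a
    w. Its determinant is a^(q+1) delta(w) / delta(w0), and the norm allows a to be chosen so that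
    this is 1. *)
Lemma nonrational_transitive w0 w : delta w0 != 0 -> delta w != 0 ->
  exists2 g, g \in SL2 F & vsim (vact j w0 g) w.
Proof.
move=> d0 dw.
have [||a a0 aE] := @norm_surj (delta w0 / delta w).
- by rewrite mulf_neq0 ?invr_eq0.
- by rewrite exprMn exprVn !delta_frob invrN mulrNN.
have [a0' [b0 e0]] := nonrational_basis d0 ((a *: w) 0 0).
have [a1 [b1 e1]] := nonrational_basis d0 ((a *: w) 0 1).
pose h : 'M[F]_2 := \matrix_(i, k)
  (if i == 0 then (if k == 0 then a0' else a1) else (if k == 0 then b0 else b1)).
have hE : w0 *m map_mx j h = a *: w.
  by apply: rV2P; rewrite mulmx_rV2 !mxE /= -?e0 -?e1 mxE.
have h1 : \det h = 1.
  apply: (fmorph_inj j); apply: (mulIf d0).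
  by rewrite -deltaM hE deltaZ aE divfK // rmorph1 mul1r.
have [g gG gh] := SL2_of_mx h1; exists g => //.
rewrite /vact gh hE vsim_sym; apply/vsimP; by exists a.
Qed.

Lemma card_equivariant_lines w0 n (r : mx_representation L (SL2_group F) n) :
  delta w0 != 0 ->
  #|equivariant r (lines j)| =
  (#|equivariant r projline| * #|stab_fix r (w0 : lines j)|)%N.
Proof.
move=> d0.
apply: (@card_equivariant_orbit _ _ _ _ r projline (lines j) (map_mx j)).
- by move=> s g; rewrite [LHS]vact_map.
- by move=> s; rewrite /= map_mx_eq0.
- by move=> s t; rewrite /= !vsimE rdet_map fmorph_eq0 !map_mx_eq0.
- by apply: contraNneq d0 => ->; rewrite /delta !mxE !mul0r subrr.
- move=> w w0'; have [dw|dw] := eqVneq (delta w) 0.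
    by left; apply: delta_eq0.
  by right; apply: nonrational_transitive.
move=> u g gG; apply/negP => /vsimP[a a0 e].
have := deltaM w0 (GLval g); rewrite -[_ *m _]/(gact (w0 : lines j) g) e deltaZ delta_map mulr0.
by move/eqP; rewrite SL2_det // rmorph1 mul1r eq_sym (negPf d0).
Qed.

End SL2Geometry.

(** * The kernel transform *)

Section IntegralOperators.
Variables (K : finFieldType) (n : nat).
Local Notation V := 'cV[K]_n.

Definition kop (S T : finType) (k : S -> T -> K) (f : {ffun S -> V}) : {ffun T -> V} :=
  [ffun t => \sum_s k s t *: f s].

Lemma kop_comp (S T U : finType) (k : S -> T -> K) (l : T -> U -> K) f u :
  kop l (kop k f) u = \sum_s (\sum_t k s t * l t u) *: f s.
Proof.
rewrite ffunE; under eq_bigr => t _ do rewrite ffunE scaler_sumr.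
rewrite exchange_big /=; apply: eq_bigr => s _; rewrite scaler_suml.
by apply: eq_bigr => t _; rewrite scalerA mulrC.
Qed.

Lemma kopB (S T : finType) (k : S -> T -> K) f h t :
  kop k (f - h) t = kop k f t - kop k h t.
Proof.
by rewrite !ffunE -sumrB; apply: eq_bigr => s _; rewrite /= !ffunE scalerBr.
Qed.

Lemma sum_kop (S T : finType) (k : S -> T -> K) f :
  \sum_t kop k f t = \sum_s (\sum_t k s t) *: f s.
Proof.
under eq_bigr => t _ do rewrite ffunE.
by rewrite exchange_big; apply: eq_bigr => s _; rewrite scaler_suml.
Qed.

Variables (gT : finGroupType) (G : {group gT}) (r : mx_representation K G n).

Lemma gact_inj (S : gset gT) g : injective (fun s : S => gact s g).
Proof. by apply: (can_inj (g := fun s => gact s g^-1%g)) => s; rewrite -gactM mulgV gact1. Qed.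

Lemma kop_equivariant (S T : gset gT) (k : S -> T -> K) f :
  (forall s t g, g \in G -> k (gact s g) (gact t g) = k s t) ->
  (forall s t t', gsim t t' -> k s t = k s t') ->
  (forall s t, ~~ gdom t -> k s t = 0) ->
  f \in equivariant r S -> kop k f \in equivariant r T.
Proof.
move=> kg ks k0 /equivariantP[_ _ fg]; apply/equivariantP; split.
- by move=> t td; rewrite ffunE big1 // => s _; rewrite k0 // scale0r.
- by move=> t t' tt; rewrite !ffunE; apply: eq_bigr => s _; rewrite (ks s t t').
move=> g t gG; rewrite !ffunE (reindex_inj (@gact_inj S g)) mulmx_sumr.
by apply: eq_bigr => s _; rewrite kg // fg // scalemxAr.
Qed.

Lemma equivariantD (S : gset gT) f h :
  f \in equivariant r S -> h \in equivariant r S -> f + h \in equivariant r S.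
Proof.
move=> /equivariantP[f0 fs fg] /equivariantP[h0 hs hg]; apply/equivariantP; split.
- by move=> s sd; rewrite ffunE f0 // h0 // addr0.
- by move=> s t st; rewrite !ffunE (fs s t) // (hs s t).
by move=> g s gG; rewrite !ffunE fg // hg // mulmxDr.
Qed.

Lemma equivariantN (S : gset gT) f :
  f \in equivariant r S -> - f \in equivariant r S.
Proof.
move=> /equivariantP[f0 fs fg]; apply/equivariantP; split.
- by move=> s sd; rewrite ffunE f0 // oppr0.
- by move=> s t st; rewrite !ffunE (fs s t).
by move=> g s gG; rewrite !ffunE fg // mulmxN.
Qed.

(** On [projline] the sum over vectors is -1 times the sum over lines. There these functions
    correspond to the maps from the Steinberg module to V, by [hom_fun_equivariant0] and
    [hom_fun_onto]. *)
Definition equivariant0 (S : gset gT) : {set {ffun S -> V}} :=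
  [set f in equivariant r S | \sum_s f s == 0].

End IntegralOperators.

Lemma sum_pair (S T : finType) (V : nmodType) (f : S * T -> V) :
  \sum_c f c = \sum_s \sum_t f (s, t).
Proof. by rewrite pair_bigA; apply: eq_bigr => -[]. Qed.

(** * The determinant kernel as a projection *)

Section Projection.
Variables (K L : finFieldType) (j : {rmorphism K -> L}) (M : nat).
Hypothesis cardK : #|K| = M.+1.

Lemma natr_card_map : M%:R = -1 :> L.
Proof.
apply/eqP; rewrite -subr_eq0 opprK -mulrSr -(rmorph_nat j).
by rewrite (natr_card_finField cardK) rmorph0.
Qed.

Lemma expr_predC (x : K) : x ^+ M = (x != 0)%:R.
Proof.
have [->|x0] := eqVneq x 0.
  by rewrite expr0n gtn_eqF // (finField_predC_gt0 cardK).
by apply: (mulfI x0); rewrite -exprS -cardK expf_card mulr1.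
Qed.

Lemma sum_dom : \sum_(u : 'rV[K]_2) (u != 0)%:R = -1 :> L.
Proof.
rewrite (bigD1 0) //= eqxx add0r (eq_bigr (fun=> 1)) => [|u ->] //.
rewrite sumr_const cardC1 card_mx cardK mul1n.
apply/eqP; rewrite -subr_eq0 opprK -mulrSr prednK ?expn_gt0 //.
by rewrite natrX -(rmorph_nat j) (natr_card_finField cardK) rmorph0 expr0n.
Qed.

(** For u nonzero, the kernel is the indicator of the x that are not multiples of u. The left side
    is thus the sum of f without the M nonzero multiples of u, where f takes the value f u; as M =
    -1, removing them adds f u. *)
Lemma proj_kernel n (f : {ffun 'rV[K]_2 -> 'cV[L]_n}) : f 0 = 0 ->
  (forall u v, vsim u v -> f u = f v) ->
  forall u, \sum_x j (rdet x u) ^+ M *: f x = f u + (u != 0)%:R *: \sum_x f x.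
Proof.
move=> f0 fs u; have [->|u0] := eqVneq u 0.
  rewrite f0 add0r scale0r big1 // => x _.
  by rewrite rdet0r rmorph0 expr0n gtn_eqF ?scale0r // (finField_predC_gt0 cardK).
rewrite scale1r; under eq_bigr => x _ do rewrite -rmorphXn expr_predC rmorph_nat.
have -> : \sum_x f x = \sum_x ((rdet x u != 0)%:R : L) *: f x +
    \sum_(x | rdet x u == 0) f x.
  rewrite [X in _ = _ + X]big_mkcond -big_split; apply: eq_bigr => x _ /=.
  by case: ifP => _; rewrite ?scale0r ?scale1r ?add0r ?addr0.
rewrite addrCA -[LHS]addr0; congr (_ + _); apply/esym.
have inj : injective (fun a : K => a *: u).
  move=> a b /eqP; rewrite -subr_eq0 -scalerBl scaler_eq0 (negPf u0) orbF subr_eq0.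
  by move/eqP.
have lin : [pred x | rdet x u == 0] =i [set a *: u | a in [set: K]].
  move=> x; rewrite inE; apply/eqP/imsetP => [xu|[a _ ->]].
    have [a ->] : exists a, x = a *: u.
      by apply: rdet_eq0P => //; rewrite -oppr0 -xu /rdet; ring.
    by exists a.
  by rewrite rdetZl /rdet [u 0 0 * _]mulrC subrr mulr0.
rewrite (eq_bigl _ _ lin) big_imset /=; last by move=> a b _ _; apply: inj.
rewrite (bigD1 0) ?inE //= scale0r f0 add0r.
rewrite (eq_bigr (fun=> f u)) => [|a /andP[_ a0]]; last first.
  by apply: fs; rewrite vsim_sym; apply/vsimP; exists a.
rewrite sumr_const.
have -> : #|[pred a in [set: K] | a != 0]| = M.
  by rewrite -[RHS]/(M.+1.-1) -cardK -(cardC1 (0 : K)); apply: eq_card => a; rewrite !inE.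
by rewrite -scaler_nat natr_card_map scaleN1r subrr.
Qed.

End Projection.

(** * The isomorphism and its inverse *)

Section Transform.
Variables (F L : finFieldType) (j : {rmorphism F -> L}) (N : nat).
Hypothesis cardF : #|F| = N.+1.
Hypothesis cardL : #|L| = (N.+1 ^ 2)%N.
Hypothesis chL : [pchar L].-nat N.+1.
Variables (n : nat) (r : mx_representation L (SL2_group F) n).

Let N_gt0 : (0 < N)%N := finField_predC_gt0 cardF.
Let cardL' : #|L| = (N + N.+1 * N).+1.
Proof. by rewrite cardL expnS expn1 mulnSr addnC mulnC. Qed.
Let frobj a : j a ^+ N.+1 = j a.
Proof. by rewrite -rmorphXn -cardF expf_card. Qed.

Local Notation P := (projline F).
Local Notation PL := (lines j).

(* On u, v in F^2 one has det(v, w^q) = det(v, w)^q, so kerK u v w is the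
   polynomial det(u, x)^(q-1) det(v, y)^(q-1) evaluated at x = w, y = w^q: this
   evaluation identifies the bihomogeneous polynomials of bidegree (q-1, q-1)
   with the homogeneous polynomials of degree q^2-1. *)
Definition kerD (u v : 'rV[F]_2) : L := rdet (map_mx j u) (map_mx j v) ^+ N.
Definition kerK (u v : 'rV[F]_2) (w : 'rV[L]_2) : L :=
  rdet (map_mx j u) w ^+ N * (rdet (map_mx j v) w ^+ N) ^+ N.+1.
Definition dF (u : 'rV[F]_2) : L := (u != 0)%:R.
Definition dL (w : 'rV[L]_2) : L := (w != 0)%:R.

Lemma kerD0r u : kerD u 0 = 0.
Proof. by rewrite /kerD map_mx0 rdet0r expr0n gtn_eqF. Qed.
Lemma kerDC u v : kerD u v = kerD v u.
Proof. exact: rdetC_exp. Qed.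
Lemma kerK0l v w : kerK 0 v w = 0.
Proof. by rewrite /kerK map_mx0 rdet0l expr0n gtn_eqF ?mul0r. Qed.
Lemma kerK0m u w : kerK u 0 w = 0.
Proof. by rewrite /kerK map_mx0 rdet0l expr0n gtn_eqF // expr0n mulr0. Qed.
Lemma kerK0r u v : kerK u v 0 = 0.
Proof. by rewrite /kerK rdet0r expr0n gtn_eqF // mul0r. Qed.

Lemma kerD_dom u v : kerD u v * dF v = kerD u v.
Proof. by rewrite /dF; case: eqP => [->|_]; rewrite ?kerD0r ?mul0r ?mulr1. Qed.
Lemma kerK_doml u v w : dF u * kerK u v w = kerK u v w.
Proof. by rewrite /dF; case: eqP => [->|_]; rewrite ?kerK0l ?mulr0 ?mul1r. Qed.
Lemma kerK_domm u v w : dF v * kerK u v w = kerK u v w.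
Proof. by rewrite /dF; case: eqP => [->|_]; rewrite ?kerK0m ?mulr0 ?mul1r. Qed.
Lemma kerK_domr u v w : dL w * kerK u v w = kerK u v w.
Proof. by rewrite /dL; case: eqP => [->|_]; rewrite ?kerK0r ?mulr0 ?mul1r. Qed.

Lemma sum_dF : \sum_u dF u = -1.
Proof. exact: (sum_dom j cardF). Qed.
Lemma sum_dL : \sum_w dL w = -1.
Proof. exact: (sum_dom (idfun : {rmorphism L -> L}) cardL'). Qed.

Lemma sum_kerDl v : \sum_u kerD u v = 0.
Proof. exact: sum_rdet. Qed.
Lemma sum_kerDr u : \sum_v kerD u v = 0.
Proof. by under eq_bigr => v _ do rewrite kerDC; exact: sum_kerDl. Qed.
Lemma sum_kerDD u v : \sum_x kerD u x * kerD x v = kerD u v.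
Proof.
rewrite [RHS]/kerD -(sum_rdetM j cardF chL); apply: eq_bigr => x _.
by rewrite kerDC.
Qed.

Lemma sum_kerKl v w : \sum_u kerK u v w = 0.
Proof. by rewrite -mulr_suml (sum_rdet j cardF chL) mul0r. Qed.
Lemma sum_kerKm u w : \sum_v kerK u v w = 0.
Proof.
by rewrite -mulr_sumr -expr_sum_pchar // (sum_rdet j cardF chL) expr0n mulr0.
Qed.
Lemma sum_kerKr u v : \sum_w kerK u v w = 0.
Proof. exact: (sum_rdet_twist cardF cardL chL). Qed.
(** With [sum_kerKKL], this says that [kerK] and its transpose compose to the reproducing kernel on
    each side: the tensor square of [kerD] on pairs of lines over F, and det^(q^2-1) on lines over
    L. The Frobenius twist disappears here because det(v, v') lies in F. *)
Lemma sum_kerKK u v u' v' :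
  \sum_w kerK u v w * kerK u' v' w = kerD u u' * kerD v v'.
Proof.
rewrite (sum_rdetM_twist cardF cardL chL); congr (_ * _).
by rewrite /kerD rdet_map -rmorphXn frobj.
Qed.
Lemma sum_kerKKL w w' :
  \sum_u \sum_v kerK u v w * kerK u v w' = rdet w w' ^+ (N + N.+1 * N).
Proof.
rewrite exprD [(N.+1 * N)%N]mulnC exprM.
rewrite -{1}(sum_rdetM j cardF chL) -(sum_rdetM j cardF chL w w').
rewrite expr_sum_pchar // mulr_suml; apply: eq_bigr => u _.
rewrite mulr_sumr; apply: eq_bigr => v _.
by rewrite /kerK mulrACA exprMn.
Qed.

Lemma kerD_proj (f : {ffun 'rV[F]_2 -> 'cV[L]_n}) : f 0 = 0 ->
  (forall u v, vsim u v -> f u = f v) ->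
  forall u, \sum_x kerD x u *: f x = f u + dF u *: \sum_x f x.
Proof.
move=> f0 fs u; rewrite -(proj_kernel j cardF) //.
by apply: eq_bigr => x _; rewrite /kerD rdet_map.
Qed.

Lemma kerL_proj f : f \in equivariant r PL ->
  forall u, \sum_x rdet x u ^+ (N + N.+1 * N) *: f x = f u + dL u *: \sum_x f x.
Proof.
move=> /equivariantP[f0 fs _] u.
rewrite -(proj_kernel (idfun : {rmorphism L -> L}) cardL') //.
by apply: f0; rewrite /= eqxx.
Qed.

Local Notation V := 'cV[L]_n.
Local Notation f11 := {ffun pairs P P -> V}.
Local Notation f1 := {ffun P -> V}.
Local Notation fL := {ffun PL -> V}.

(* Writing d for the indicator of the nonzero vectors, f + (sum of f) d is the
   image of f under D by proj_kernel. The kernels below are arranged so that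
   synthesis o analysis has kernel (D - d) (x) (D - d), hence is the identity. *)
Definition kerLine (c : pairs P P) (w : PL) := kerK c.1 c.2 w - dL w.
Definition kerFst (c : pairs P P) (x : P) := kerD c.1 x.
Definition kerSnd (c : pairs P P) (x : P) := kerD c.2 x.
Definition kerLine' (w : PL) (c : pairs P P) := kerK c.1 c.2 w + dF c.1 * dF c.2.
Definition kerFst' (x : P) (c : pairs P P) := kerD x c.1 * dF c.2.
Definition kerSnd' (x : P) (c : pairs P P) := kerD x c.2 * dF c.1.

Definition analysis (f : f11) : fL * (f1 * f1) :=
  (kop kerLine f, (kop kerFst f, kop kerSnd f)).
Definition synthesis (d : fL * (f1 * f1)) : f11 :=
  kop kerLine' d.1 - kop kerFst' d.2.1 - kop kerSnd' d.2.2.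

Lemma analysisK f : f \in equivariant r (pairs P P) -> synthesis (analysis f) = f.
Proof.
move=> fE; have /equivariantP[f0 fs _] := fE.
have subE (a b : f11) c : (a - b) c = a c - b c by rewrite !ffunE.
apply/ffunP => -[u v]; rewrite /synthesis /analysis !subE /= !kop_comp -!sumrB.
have E (c : P * P) :
   \sum_w kerLine c w * kerLine' w (u, v) - \sum_x kerFst c x * kerFst' x (u, v)
    - \sum_x kerSnd c x * kerSnd' x (u, v) =
  (kerD c.1 u - dF u) * (kerD c.2 v - dF v).
  have -> : \sum_x kerFst c x * kerFst' x (u, v) = kerD c.1 u * dF v.
    by rewrite -sum_kerDD mulr_suml; apply: eq_bigr => x _; rewrite mulrA.
  have -> : \sum_x kerSnd c x * kerSnd' x (u, v) = kerD c.2 v * dF u.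
    by rewrite -sum_kerDD mulr_suml; apply: eq_bigr => x _; rewrite mulrA.
  (* The corrections - dL and + dF dF contribute exactly dF u * dF v, because [dL] sums to -1 and
     [kerK] sums to 0 over w. *)
  have -> : \sum_w kerLine c w * kerLine' w (u, v) =
     kerD c.1 u * kerD c.2 v + dF u * dF v.
    rewrite -sum_kerKK /kerLine /kerLine' /=.
    transitivity (\sum_w (kerK c.1 c.2 w * kerK u v w - kerK u v w +
        (dF u * dF v) * (kerK c.1 c.2 w) - (dF u * dF v) * dL w)).
      by apply: eq_bigr => w _; rewrite mulrDr !mulrBl kerK_domr; ring.
    rewrite sumrB big_split sumrB /= -!mulr_sumr !sum_kerKr sum_dL.
    by ring.
  by ring.
rewrite (eq_bigr (fun c => ((kerD c.1 u - dF u) * (kerD c.2 v - dF v)) *: f c)); last first.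
  by move=> c _; rewrite -E !scalerBl.
(* Subtracting [dF x] removes the total sum of h that [kerD] adds, so D - d reproduces h without a
   condition on its sum. It is applied to each variable in turn. *)
have proj (h : {ffun 'rV[F]_2 -> V}) x : h 0 = 0 -> (forall u v, vsim u v -> h u = h v) ->
    \sum_u (kerD u x - dF x) *: h u = h x.
  move=> h0 hs; under eq_bigr => z _ do rewrite scalerBl.
  by rewrite sumrB kerD_proj // -scaler_sumr addrK.
rewrite sum_pair /=.
transitivity (\sum_u' (kerD u' u - dF u) *: f (u', v)).
  apply: eq_bigr => u' _; under eq_bigr => v' _ do rewrite -scalerA.
  rewrite -scaler_sumr; congr (_ *: _).
  pose h : {ffun 'rV[F]_2 -> V} := [ffun v' => f (u', v')].
  have <- : h v = f (u', v) by rewrite ffunE.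
  rewrite -(proj h).
  - by apply: eq_bigr => v' _; rewrite ffunE.
  - by rewrite ffunE f0 //= /pdom /= eqxx andbF.
  by move=> x y xy; rewrite !ffunE; apply: fs; rewrite /= /psim /= vsim_refl.
pose h : {ffun 'rV[F]_2 -> V} := [ffun u' => f (u', v)].
have <- : h u = f (u, v) by rewrite ffunE.
rewrite -(proj h).
- by apply: eq_bigr => u' _; rewrite ffunE.
- by rewrite ffunE f0 //= /pdom /= eqxx.
by move=> x y xy; rewrite !ffunE; apply: fs; rewrite /= /psim /= vsim_refl andbT.
Qed.

(** The diagonal blocks of the composite are the projection on P^1(L) and, twice, [kerD] itself,
    which reproduces only functions of sum zero: this is why the last two components are so
    restricted. The off-diagonal blocks vanish because [kerD] and [kerK] sum to zero over each
    argument. *)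
Lemma synthesisK d : d.1 \in equivariant r PL -> d.2.1 \in equivariant0 r P ->
  d.2.2 \in equivariant0 r P -> analysis (synthesis d) = d.
Proof.
case: d => f [a b] /= fE /setIdP[aE /eqP a0] /setIdP[bE /eqP b0].
have proj (h : f1) x : h \in equivariant r P -> \sum_u h u = 0 ->
    \sum_u kerD u x *: h u = h x.
  move=> /equivariantP[h0 hs _] hsum; rewrite kerD_proj //; last by apply: h0; rewrite /= eqxx.
  by rewrite hsum scaler0 addr0.
congr (_, (_, _)); apply/ffunP => x.
- rewrite !kopB !kop_comp.
  have E1 w : \sum_c kerLine' w c * kerLine c x = rdet w x ^+ (N + N.+1 * N) - dL x.
    transitivity (\sum_u \sum_v (kerK u v w * kerK u v x - kerK u v w * dL x +
       kerK u v x - dF u * (dF v * dL x))).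
      rewrite sum_pair; apply: eq_bigr => u _; apply: eq_bigr => v _.
      rewrite /kerLine' /kerLine /= mulrBr [in LHS]mulrDl -[dF u * _ * _]mulrA.
      by rewrite kerK_domm kerK_doml; ring.
    under eq_bigr => u _ do rewrite sumrB big_split sumrB /= -!mulr_suml sum_kerKm
      mul0r subr0 sum_kerKm addr0 -mulr_sumr -mulr_suml sum_dF.
    by rewrite sumrB sum_kerKKL -mulr_suml sum_dF; ring.
  have E2 y : \sum_c kerFst' y c * kerLine c x = 0.
    rewrite sum_pair.
    under eq_bigr => u _.
      under eq_bigr => v _ do rewrite /kerFst' /kerLine /= -mulrA mulrBr kerK_domm.
      rewrite -mulr_sumr sumrB sum_kerKm -mulr_suml sum_dF sub0r mulN1r opprK.
      over.
    by rewrite -mulr_suml sum_kerDr mul0r.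
  have E3 y : \sum_c kerSnd' y c * kerLine c x = 0.
    rewrite sum_pair exchange_big /=.
    under eq_bigr => v _.
      under eq_bigr => u _ do rewrite /kerSnd' /kerLine /= -mulrA mulrBr kerK_doml.
      rewrite -mulr_sumr sumrB sum_kerKl -mulr_suml sum_dF sub0r mulN1r opprK.
      over.
    by rewrite -mulr_suml sum_kerDr mul0r.
  under eq_bigr => w _ do rewrite E1 scalerBl.
  rewrite sumrB kerL_proj // -scaler_sumr addrK.
  rewrite big1 => [|y _]; last by rewrite E2 scale0r.
  by rewrite big1 => [|y _]; rewrite ?subr0 // E3 scale0r.
- rewrite !kopB !kop_comp.
  have E1 w : \sum_c kerLine' w c * kerFst c x = 0.
    rewrite sum_pair /kerLine' /kerFst /kerSnd /kerFst' /kerSnd' /=.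
    under eq_bigr => u _ do rewrite -mulr_suml big_split /= sum_kerKm add0r -mulr_sumr
      sum_dF mulrN1 mulNr kerDC mulrC kerD_dom kerDC.
    by rewrite sumrN sum_kerDl oppr0.
  (* The sign is the sum of [dF] over the free variable; the minus signs in [synthesis] compensate
     for it. *)
  have E2 y : \sum_c kerFst' y c * kerFst c x = - kerD y x.
    rewrite sum_pair /kerLine' /kerFst /kerSnd /kerFst' /kerSnd' /=.
    under eq_bigr => u _ do rewrite -mulr_suml -mulr_sumr sum_dF mulrN1 mulNr.
    by rewrite sumrN sum_kerDD.
  have E3 y : \sum_c kerSnd' y c * kerFst c x = 0.
    rewrite sum_pair /kerLine' /kerFst /kerSnd /kerFst' /kerSnd' /= big1 // => u _.
    by rewrite -mulr_suml -mulr_suml sum_kerDr !mul0r.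
  rewrite big1 => [|y _]; last by rewrite E1 scale0r.
  rewrite sub0r -sumrN [X in _ - X]big1 => [|y _]; last by rewrite E3 scale0r.
  rewrite subr0 -[RHS]proj //.
  by apply: eq_bigr => y _; rewrite E2 scaleNr opprK.
- rewrite !kopB !kop_comp.
  have E1 w : \sum_c kerLine' w c * kerSnd c x = 0.
    rewrite sum_pair /kerLine' /kerFst /kerSnd /kerFst' /kerSnd' /= exchange_big /=.
    under eq_bigr => u _ do rewrite -mulr_suml big_split /= sum_kerKl add0r -mulr_suml
      sum_dF mulN1r mulNr kerDC mulrC kerD_dom kerDC.
    by rewrite sumrN sum_kerDl oppr0.
  have E2 y : \sum_c kerSnd' y c * kerSnd c x = - kerD y x.
    rewrite sum_pair /kerLine' /kerFst /kerSnd /kerFst' /kerSnd' /= exchange_big /=.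
    under eq_bigr => u _ do rewrite -mulr_suml -mulr_sumr sum_dF mulrN1 mulNr.
    by rewrite sumrN sum_kerDD.
  have E3 y : \sum_c kerFst' y c * kerSnd c x = 0.
    rewrite sum_pair /kerLine' /kerFst /kerSnd /kerFst' /kerSnd' /= exchange_big /= big1 // => u _.
    by rewrite -mulr_suml -mulr_suml sum_kerDr !mul0r.
  rewrite big1 => [|y _]; last by rewrite E1 scale0r.
  rewrite [X in _ - X - _]big1 => [|y _]; last by rewrite E3 scale0r.
  rewrite !sub0r oppr0 add0r -sumrN -[RHS]proj //.
  by apply: eq_bigr => y _; rewrite E2 scaleNr opprK.
Qed.

Lemma kerD_act u v g : g \in SL2 F ->
  kerD (gact (u : P) g) (gact (v : P) g) = kerD u v.
Proof. by move=> gG; rewrite /kerD !rdet_map rdet_vact. Qed.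

Lemma kerK_act u v w g : g \in SL2 F ->
  kerK (gact (u : P) g) (gact (v : P) g) (gact (w : PL) g) = kerK u v w.
Proof. by move=> gG; rewrite /kerK !(vact_map j) !rdet_vact. Qed.

Lemma dF_act u g : dF (gact (u : P) g) = dF u.
Proof. by rewrite /dF (vdom_act (idfun : {rmorphism F -> F})). Qed.

Lemma dL_act w g : dL (gact (w : PL) g) = dL w.
Proof. by rewrite /dL (vdom_act j). Qed.

Let expN (a : F) : a != 0 -> j a ^+ N = 1.
Proof. by move=> a0; rewrite -rmorphXn (expr_predC cardF) a0 rmorph1. Qed.

Lemma kerD_sim u v v' : vsim v v' -> kerD u v = kerD u v'.
Proof.
by case/vsimP => a a0 ->; rewrite /kerD map_mxZ rdetZr exprMn expN ?mul1r.
Qed.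

(** A scalar c of w contributes c^((q-1) + q(q-1)) = c^(q^2-1) = 1, and scalars of u and v lie in F,
    where (q-1)-th powers are 1. *)
Lemma kerK_sim u v w u' v' w' : vsim u u' -> vsim v v' -> vsim w w' ->
  kerK u v w = kerK u' v' w'.
Proof.
case/vsimP => a a0 -> /vsimP[b b0 ->] /vsimP[c c0 ->].
rewrite /kerK !map_mxZ !rdetZl !rdetZr !exprMn !expN // !mul1r expr1n mul1r mulrACA.
by rewrite -[c ^+ N ^+ N.+1]exprM -exprD [(N * _)%N]mulnC (expr_predC cardL') c0 mul1r.
Qed.

Lemma dF_sim u v : vsim u v -> dF u = dF v.
Proof. by rewrite /dF => /vsim_dom->. Qed.

Lemma dL_sim u v : vsim u v -> dL u = dL v.
Proof. by rewrite /dL => /vsim_dom->. Qed.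

Lemma analysis_equivariant f : f \in equivariant r (pairs P P) ->
  [/\ (analysis f).1 \in equivariant r PL, (analysis f).2.1 \in equivariant0 r P &
     (analysis f).2.2 \in equivariant0 r P].
Proof.
move=> fE; split.
- apply: kop_equivariant fE => [[u v] w g gG|[u v] w w' ww|c w].
  + by rewrite /kerLine kerK_act // dL_act.
  + by rewrite /kerLine (kerK_sim (vsim_refl _) (vsim_refl _) ww) (dL_sim ww).
  + by rewrite negbK => /eqP ->; rewrite /kerLine /dL kerK0r eqxx subrr.
- rewrite inE sum_kop big1 ?eqxx ?andbT => [|c _]; last by rewrite sum_kerDr scale0r.
  apply: kop_equivariant fE => [[u v] w g gG|[u v] w w' ww|c w].
  + by rewrite /kerFst kerD_act.
  + by rewrite /kerFst (kerD_sim _ ww).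
  + by rewrite negbK => /eqP ->; rewrite /kerFst kerD0r.
rewrite inE sum_kop big1 ?eqxx ?andbT => [|c _]; last by rewrite sum_kerDr scale0r.
apply: kop_equivariant fE => [[u v] w g gG|[u v] w w' ww|c w].
+ by rewrite /kerSnd kerD_act.
+ by rewrite /kerSnd (kerD_sim _ ww).
+ by rewrite negbK => /eqP ->; rewrite /kerSnd kerD0r.
Qed.

Lemma synthesis_equivariant d : d.1 \in equivariant r PL -> d.2.1 \in equivariant r P ->
  d.2.2 \in equivariant r P -> synthesis d \in equivariant r (pairs P P).
Proof.
move=> d1 d2 d3; apply: equivariantD; [apply: equivariantD|]; rewrite ?equivariantN //.
- apply: kop_equivariant d1 => [w [u v] g gG|w [u v] [u' v'] /andP[/= uu vv]|w [u v]].
  + by rewrite /kerLine' kerK_act // !dF_act.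
  + by rewrite /kerLine' (kerK_sim uu vv (vsim_refl _)) (dF_sim uu) (dF_sim vv).
  + rewrite negb_and !negbK => /orP[] /= /eqP ->;
    by rewrite /kerLine' /= /dF ?kerK0l ?kerK0m eqxx ?mul0r ?mulr0 addr0.
- apply: kop_equivariant d2 => [w [u v] g gG|w [u v] [u' v'] /andP[/= uu vv]|w [u v]].
  + by rewrite /kerFst' kerD_act // !dF_act.
  + by rewrite /kerFst' (kerD_sim _ uu) (dF_sim vv).
  + rewrite negb_and !negbK => /orP[] /= /eqP ->;
    by rewrite /kerFst' /= /dF ?kerD0r ?eqxx ?mul0r ?mulr0.
apply: kop_equivariant d3 => [w [u v] g gG|w [u v] [u' v'] /andP[/= uu vv]|w [u v]].
+ by rewrite /kerSnd' kerD_act // !dF_act.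
+ by rewrite /kerSnd' (kerD_sim _ vv) (dF_sim uu).
+ rewrite negb_and !negbK => /orP[] /= /eqP ->;
  by rewrite /kerSnd' /= /dF ?kerD0r ?eqxx ?mul0r ?mulr0.
Qed.

Lemma card_equivariant_transform :
  #|equivariant r (pairs P P)| =
  (#|equivariant r PL| * (#|equivariant0 r P| * #|equivariant0 r P|))%N.
Proof.
rewrite -!cardsX -(card_in_imset (can_in_inj analysisK)).
apply: eq_card => -[d1 [d2 d3]]; rewrite !in_setX.
apply/imsetP/and3P => [[f fE dE]|[d1E d2E d3E]].
  by have := analysis_equivariant fE; rewrite -dE.
exists (synthesis (d1, (d2, d3))); last by rewrite synthesisK.
apply: synthesis_equivariant => //=.
  by move: d2E; rewrite inE => /andP[].
by move: d3E; rewrite inE => /andP[].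
Qed.

End Transform.

(** * The Steinberg module *)

Section ScalarExtension.
Variables (F L : finFieldType) (j : {rmorphism F -> L}).
Hypothesis cardL : #|L| = (#|F| ^ 2)%N.
Variables (gT : finGroupType) (G : {group gT}) (n : nat) (r : mx_representation F G n).
Variable theta : L.
Hypothesis theta_notin : forall a, j a != theta.

Lemma quadratic_inj (a b : F) : j a + theta * j b = 0 -> a = 0 /\ b = 0.
Proof.
move=> e; have b0 : b = 0.
  apply: contraTeq (theta_notin (- (a / b))) => b0; rewrite negbK rmorphN.
  by rewrite fmorph_div -(inj_eq (mulIf (x := j b) _)) ?fmorph_eq0 // mulNr divfK
    ?fmorph_eq0 // eq_sym -subr_eq0 opprK addrC e.
by move/eqP: e; rewrite b0 rmorph0 mulr0 addr0 fmorph_eq0 => /eqP.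
Qed.

(** Coordinates of L^n over F in the basis 1, theta of L. *)
Definition cmb (c : 'cV[F]_n * 'cV[F]_n) : 'cV[L]_n :=
  map_mx j c.1 + theta *: map_mx j c.2.

Lemma cmbB c d : cmb (c.1 - d.1, c.2 - d.2) = cmb c - cmb d.
Proof. by rewrite /cmb /= !map_mxB scalerBr opprD addrACA. Qed.

Lemma cmb_eq0 c : cmb c = 0 -> c = (0, 0).
Proof.
case: c => x y /colP e; congr (_, _); apply/colP => i; have := e i;
by rewrite !mxE => /quadratic_inj[].
Qed.

Lemma cmb_inj : injective cmb.
Proof.
move=> [x y] [x' y'] /eqP; rewrite -subr_eq0 -cmbB => /eqP/cmb_eq0[/eqP e1 /eqP e2].
by move: e1 e2; rewrite !subr_eq0 => /eqP-> /eqP->.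
Qed.

Lemma cmb_bij : bijective cmb.
Proof.
apply: inj_card_bij cmb_inj _.
by rewrite card_prod !card_mx cardL !muln1 -expnM mulnC expnM expnS expn1.
Qed.

Lemma cmbM A x y : cmb (A *m x, A *m y) = map_mx j A *m cmb (x, y).
Proof. by rewrite /cmb /= !map_mxM mulmxDr scalemxAr. Qed.

(** The group acts by matrices over F, so every condition on a function with values in L^n splits
    into the same condition on its two components over F. *)
Lemma card_equivariant0_extend (S : gset gT) :
  #|equivariant0 (map_repr j r) S| = (#|equivariant0 r S| ^ 2)%N.
Proof.
have [split splitK cmbK] := cmb_bij.
pose T (c : {ffun S -> 'cV[F]_n} * {ffun S -> 'cV[F]_n}) : {ffun S -> 'cV[L]_n} :=
  [ffun s => cmb (c.1 s, c.2 s)].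
have T_inj : injective T.
  move=> [a b] [a' b'] /ffunP e; congr (_, _); apply/ffunP => s;
  by have := e s; rewrite !ffunE => /cmb_inj[].
have cmb0 : cmb (0, 0) = 0 by rewrite /cmb /= !map_mx0 scaler0 addr0.
have cmb_sum (a b : S -> 'cV[F]_n) :
    \sum_s cmb (a s, b s) = cmb (\sum_s a s, \sum_s b s).
  by rewrite /cmb /= !raddf_sum -big_split.
rewrite expnS expn1 -cardsX -(card_imset _ T_inj).
apply: eq_card => f; apply/idP/imsetP => [/setIdP[fE /eqP fsum]|[[a b]]].
  have /equivariantP[f0 fs fg] := fE.
  pose a := [ffun s => (split (f s)).1]; pose b := [ffun s => (split (f s)).2].
  have abs s : (a s, b s) = split (f s) by rewrite !ffunE -surjective_pairing.
  have abE s : cmb (a s, b s) = f s by rewrite abs cmbK.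
  have split0 : split 0 = (0, 0) by rewrite -cmb0 splitK.
  exists (a, b); last by apply/ffunP => s; rewrite ffunE abE.
  have sumE : (\sum_s a s, \sum_s b s) = (0, 0).
    apply: cmb_inj; rewrite -cmb_sum cmb0 -[RHS]fsum.
    by apply: eq_bigr => s _; rewrite abE.
  have e0 s : ~~ gdom s -> (a s, b s) = (0, 0) by move=> sd; rewrite abs f0.
  have es s t : gsim s t -> (a s, b s) = (a t, b t) by move=> st; rewrite !abs (fs s t).
  have eg g s : g \in G -> (a (gact s g), b (gact s g)) =
       (r g^-1%g *m a s, r g^-1%g *m b s).
    by move=> gG; apply: cmb_inj; rewrite abE fg // cmbM abE.
  case: sumE => sa sb; rewrite in_setX; apply/andP; split; apply/setIdP; split;
    rewrite ?sa ?sb //; apply/equivariantP; split.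
  - by move=> s /e0[].
  - by move=> s t /es[].
  - by move=> g s /eg-/(_ s)[].
  - by move=> s /e0[].
  - by move=> s t /es[].
  by move=> g s /eg-/(_ s)[].
rewrite in_setX => /andP[/setIdP[/equivariantP[a0 as_ ag] /eqP sa]].
move=> /setIdP[/equivariantP[b0 bs bg] /eqP sb] ->.
apply/setIdP; split; last first.
  by under eq_bigr => s _ do rewrite ffunE; rewrite cmb_sum sa sb cmb0.
apply/equivariantP; split.
- by move=> s sd; rewrite ffunE /= a0 // b0.
- by move=> s t st; rewrite !ffunE /= (as_ s t) // (bs s t).
by move=> g s gG; rewrite !ffunE /= ag // bg // cmbM.
Qed.

End ScalarExtension.

(** * Maps from the Steinberg module as functions on the projective line *)

Section HomSteinberg.
Variables (F : finFieldType) (p e n : nat) (rV : mx_representation F (SL2 F) n).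
Hypothesis p_prime : prime p.
Hypothesis cardFp : #|F| = (p ^ e)%N.

Local Notation N := (#|F|.-1).
Local Notation St := (steinberg F p).
Local Notation X := ('X_0 : {mpoly F[2]}).
Local Notation Y := ('X_1 : {mpoly F[2]}).

Let cardF : #|F| = N.+1.
Proof. by rewrite prednK // cardFp expn_gt0 prime_gt0. Qed.
Let chF : [pchar F].-nat N.+1.
Proof. by rewrite -cardF cardFp pnatX pnatE // (card_finPcharP cardFp). Qed.
Let chP : [pchar {mpoly F[2]}].-nat N.+1.
Proof.
rewrite -cardF cardFp pnatX pnatE //; apply/orP; left.
rewrite inE p_prime /= -mpolyC_nat mpolyC_eq0.
by have := card_finPcharP cardFp p_prime; rewrite inE => /andP[].
Qed.
Let N_gt0 := finField_predC_gt0 cardF.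

Lemma linear_form_homog (a b : F) : a *: Y - b *: X \is 1.-homog.
Proof. by apply: rpredB; apply: dhomogZ; rewrite dhomogX /= mdeg1. Qed.

Lemma kpoly_homog (u : 'rV[F]_2) : (u 0 0 *: Y - u 0 1 *: X) ^+ N \is N.-homog.
Proof. by rewrite -[X in X.-homog]mul1n; apply: dhomogMn; exact: linear_form_homog. Qed.

(** The polynomial det(u, (X, Y))^(q-1), the image in the Steinberg module of the line of u. *)
Definition kpoly u : dhomog 2 F N := DHomog (kpoly_homog u).
Definition kst u : subvs_of St := vsproj St (kpoly u).

Lemma vsval_kst u : vsval (kst u) = kpoly u.
Proof. by apply: vsprojK; rewrite (steinberg_full p_prime cardFp) memvf. Qed.

Definition ev (u : 'rV[F]_2) (f : dhomog 2 F N) : F := (val f).@[fun i => u 0 i].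

Lemma evP u c f h : ev u (c *: f + h) = c * ev u f + ev u h.
Proof. by rewrite /ev /= mevalD mevalZ. Qed.

Lemma ev_kpoly u v : ev u (kpoly v) = rdet v u ^+ N.
Proof.
by rewrite /ev /= rmorphXn /= mevalB !mevalZ !mevalXU.
Qed.

(** The action substitutes (X, Y) g for (X, Y), and det(v g, (X, Y) g) = det(v, (X, Y)) with v = u
    g^-1. *)
Lemma steinberg_act_kst u g : g \in SL2 F ->
  steinberg_act g (kst u) = kst (vact (idfun : {rmorphism F -> F}) u g^-1%g).
Proof.
move=> gG; apply: val_inj; rewrite /= (vsval_steinberg_act _ _ p_prime cardFp) !vsval_kst.
set v := vact _ _ _.
have uE : u = v *m GLval g.
  rewrite /v -[RHS](_ : vact (idfun : {rmorphism F -> F})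
      (vact (idfun : {rmorphism F -> F}) u g^-1%g) g = _).
    by rewrite -vactM mulVg vact1.
  by congr (_ *m _); apply/matrixP => k l; rewrite mxE.
clearbody v; apply: val_inj; rewrite /= rmorphXn /=; congr (_ ^+ _).
rewrite linearB !linearZ /= !comp_mpolyXU /= uE !mulmx_rV2.
rewrite -[RHS]scale1r -(SL2_det gG) det_mx22.
rewrite -!mul_mpolyC !rmorphB !rmorphD !rmorphM /=.
ring.
Qed.

Lemma kst0 : kst 0 = 0.
Proof.
apply: val_inj; rewrite /= vsval_kst; apply: val_inj.
by rewrite /= !mxE !scale0r subrr expr0n gtn_eqF.
Qed.

Lemma kst_sim u v : vsim u v -> kst u = kst v.
Proof.
case/vsimP => a a0 ->; apply: val_inj; rewrite /= !vsval_kst; apply: val_inj.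
rewrite /= !mxE -!scalerA -scalerBr exprZn (expr_predC cardF) a0 scale1r //.
Qed.

Lemma kpoly_geometric (u : 'rV[F]_2) : (u 0 0 *: Y - u 0 1 *: X) ^+ N =
  \sum_(i < N.+1) (u 0 0 ^+ (N - i) * u 0 1 ^+ i) *: (X ^+ i * Y ^+ (N - i)).
Proof.
rewrite exprB_geometric //; apply: eq_bigr => i _.
by rewrite !exprZn -scalerAl -scalerAr scalerA mulrC [Y ^+ _ * _]mulrC.
Qed.

Lemma sum_kst : \sum_u kst u = 0.
Proof.
apply: val_inj; rewrite raddf_sum /=; under eq_bigr => u _ do rewrite vsval_kst.
apply: val_inj; rewrite raddf_sum /=; under eq_bigr => u _ do rewrite kpoly_geometric.
rewrite exchange_big big1 //= => i _; rewrite -scaler_suml.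
by rewrite (sum_monomial_N cardF) ?scale0r // subnK // -ltnS.
Qed.

Lemma ev_monomial u (i : 'I_N.+1) : ev u (monomial F i) = u 0 0 ^+ i * u 0 1 ^+ (N - i).
Proof. by rewrite /ev /= mevalM !rmorphXn /= !mevalXU. Qed.

(** By linearity f may be a monomial X^i Y^(N-i). The coefficient of X^k Y^(N-k) on the right is
    then a power sum over u of total degree 2N, equal to 1 for k = i and to 0 otherwise. In
    particular the [kst u] span the module. *)
Lemma ev_reproducing (f : subvs_of St) : f = \sum_u ev u (vsval f) *: kst u.
Proof.
apply: val_inj; rewrite raddf_sum /=.
under eq_bigr => u _ do rewrite vsval_kst.
pose D (h : dhomog 2 F N) := h - \sum_u ev u h *: kpoly u.
have Dlin : linear D.
  move=> c h h'; rewrite /D scalerBr addrACA -opprD scaler_sumr -big_split /=.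
  congr (_ - _); apply: eq_bigr => u _.
  by rewrite evP scalerDl scalerA.
pose M := GRing.isLinear.Build F _ _ _ D Dlin.
pose DL : {linear _ -> _} := HB.pack D M.
suff /subvP/(_ _ (subvsP f)) : (St <= lker (linfun DL))%VS.
  by rewrite memv_ker lfunE /= subr_eq0 => /eqP.
apply/span_subvP => _ /mapP[i _ ->]; rewrite memv_ker lfunE /= subr_eq0; apply/eqP.
apply: val_inj; rewrite raddf_sum /=.
under eq_bigr => u _ do rewrite ev_monomial kpoly_geometric scaler_sumr.
rewrite exchange_big /=.
transitivity (\sum_(k < N.+1) ((i + (N - k) == N)%N%:R : F) *: (X ^+ k * Y ^+ (N - k))).
  rewrite (bigD1 i) //= subnKC ?eqxx ?scale1r -1?ltnS // big1 ?addr0 // => k ki.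
  have kN : (k <= N)%N by rewrite -ltnS.
  rewrite -[X in _ == X](subnK kN) addnC eqn_add2l.
  by rewrite val_eqE eq_sym (negPf ki) scale0r.
apply: eq_bigr => k _; under eq_bigr => u _ do rewrite scalerA mulrACA -!exprD.
rewrite -scaler_suml (sum_monomial_2N cardF) //.
have kN : (k <= N)%N by rewrite -ltnS.
by have iN : (i <= N)%N by [rewrite -ltnS]; rewrite addnACA subnKC // subnK.
Qed.

Lemma ev_steinberg_act u g (f : subvs_of St) :
  ev u (vsval (steinberg_act g f)) = ev (u *m GLval g) (vsval f).
Proof.
rewrite (vsval_steinberg_act _ _ p_prime cardFp) /ev /= comp_mpoly_meval.
apply: meval_eq => i; rewrite mulmx_rV2.
by case: i => -[|[|//]] lti; rewrite (tnth_nth 0) /= mevalD !mevalZ !mevalXU mulrC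
  [X in _ + X = _]mulrC; congr (_ * g _ _ + _ * g _ _); apply: val_inj.
Qed.

Local Notation E0 :=
  (equivariant0 (rV : mx_representation F (SL2_group F) n) (projline F)).

Definition hom_fun (f : 'Hom(subvs_of St, 'cV[F]_n)) : {ffun projline F -> 'cV[F]_n} :=
  [ffun u => f (kst u)].

Lemma hom_funK (f : 'Hom(subvs_of St, 'cV[F]_n)) P :
  f P = \sum_u ev u (vsval P) *: hom_fun f u.
Proof.
rewrite [in LHS](ev_reproducing P) linear_sum.
by apply: eq_bigr => u _; rewrite linearZ /= ffunE.
Qed.

Lemma hom_fun_inj : injective hom_fun.
Proof. by move=> f h fh; apply/lfunP => P; rewrite !hom_funK fh. Qed.

Lemma hom_fun_equivariant0 f : f \in Hom_steinberg p rV -> hom_fun f \in E0.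
Proof.
move/Hom_steinbergP => fH; apply/setIdP; split; last first.
  by under eq_bigr => u _ do rewrite ffunE; rewrite -linear_sum sum_kst linear0.
apply/equivariantP; split.
- by move=> u; rewrite negbK => /eqP->; rewrite ffunE kst0 linear0.
- by move=> u v uv; rewrite !ffunE (kst_sim uv).
move=> g u gG; rewrite !ffunE -fH ?groupV // steinberg_act_kst ?groupV //.
by rewrite invgK.
Qed.

(** The reproducing formula leaves one candidate, P -> sum of P(u) h(u). Its value at [kst u] is the
    transform of h by det^(q-1), which is h u because h has sum zero. *)
Lemma hom_fun_onto h : h \in E0 -> exists2 f, f \in Hom_steinberg p rV & hom_fun f = h.
Proof.
case/setIdP => /equivariantP[h0 hs hg] /eqP hsum.
pose D (P : subvs_of St) := \sum_(u : projline F) ev u (vsval P) *: h u.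
have Dlin : linear D.
  move=> c P Q; rewrite /D scaler_sumr -big_split /=; apply: eq_bigr => u _.
  by rewrite evP scalerDl scalerA.
pose M := GRing.isLinear.Build F _ _ _ D Dlin.
pose DL : {linear _ -> _} := HB.pack D M.
exists (linfun DL).
  apply/Hom_steinbergP => g gG P; rewrite !lfunE /= /D mulmx_sumr.
  rewrite [RHS](reindex_inj (@gact_inj _ (projline F) g)); apply: eq_bigr => u _ /=.
  rewrite ev_steinberg_act -scalemxAr hg // mulmxA -repr_mxM ?groupV // mulgV repr_mx1 mul1mx.
  by congr (ev _ _ *: _); congr (_ *m _); apply/matrixP => k l; rewrite mxE.
apply/ffunP => u; rewrite ffunE lfunE /= /D vsval_kst.
have := proj_kernel (idfun : {rmorphism F -> F}) cardF (f := h) _ hs u.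
rewrite hsum scaler0 addr0 => <-; last by apply: h0; rewrite /= eqxx.
by apply: eq_bigr => v _; rewrite ev_kpoly rdetC_exp.
Qed.

Lemma card_Hom_steinberg : #|E0| = (#|F| ^ \dim (Hom_steinberg p rV))%N.
Proof.
set H := Hom_steinberg p rV; set d := \dim H.
pose comb (c : 'rV[F]_d) := \sum_i c 0 i *: (vbasis H)`_i.
have combK : cancel comb (fun v => \row_i coord (vbasis H) i v).
  have freeH : free (vbasis H) := basis_free (vbasisP H).
  by move=> c; apply/rowP => i; rewrite mxE coord_sum_free.
have comb_inj : injective (hom_fun \o comb) := inj_comp hom_fun_inj (can_inj combK).
rewrite -[d]mul1n -card_mx -(card_imset _ comb_inj).
apply: eq_card => h; apply/idP/imsetP => [/hom_fun_onto[f fH <-]|[c _ ->]].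
  exists (\row_i coord (vbasis H) i f) => //=; congr hom_fun.
  rewrite {1}(coord_vbasis fH); apply: eq_bigr => i _; by rewrite mxE.
apply: hom_fun_equivariant0; apply: rpred_sum => i _.
by rewrite rpredZ ?vbasis_mem ?memt_nth.
Qed.

End HomSteinberg.

(** * Means of Brauer characters over cyclic groups *)

Lemma char_poly_similar (K : fieldType) n (P A B : 'M[K]_n) :
  P \in unitmx -> P *m A = B *m P -> char_poly A = char_poly B.
Proof.
move=> Pu PA; have dP : (\det P)%:P != 0 :> {poly K}.
  by rewrite polyC_eq0 -unitfE -unitmxE.
apply: (mulfI dP); rewrite /char_poly -det_map_mx [RHS]mulrC -!det_mulmx.
congr (\det _); rewrite /char_poly_mx mulmxBr mulmxBl -!map_mxM PA.
by rewrite scalar_mxC.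
Qed.

Lemma mup_prod_XsubC (K : fieldType) n (d : 'I_n -> K) a :
  mup a (\prod_i ('X - (d i)%:P)) = #|[pred i | d i == a]|.
Proof.
rewrite (bigID [pred i | d i == a]) /= mupMl; last first.
  rewrite rootE horner_prod; apply/prodf_neq0 => i di.
  by rewrite hornerXsubC subr_eq0 eq_sym.
rewrite (eq_bigr (fun=> 'X - a%:P)) => [|i /eqP-> //].
by rewrite prodr_const mup_XsubCX eqxx.
Qed.

Lemma sum_roots_prod_XsubC (K : finFieldType) (V : nmodType) n (d : 'I_n -> K) (f : K -> V)
    (chi := \prod_i ('X - (d i)%:P)) :
  \sum_(a | root chi a) f a *+ mup a chi = \sum_i f (d i).
Proof.
rewrite big_mkcond /= (partition_big d predT) //=; apply: eq_bigr => a _.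
rewrite (eq_bigr (fun=> f a)) => [|i /eqP-> //].
rewrite sumr_const /chi mup_prod_XsubC; case: ifP => // /negbT/mupNroot.
by rewrite mup_prod_XsubC => ->; rewrite mulr0n.
Qed.

Section TorusMean.
Variables (F L : finFieldType) (j : {rmorphism F -> L}).
Variables (R : realType) (iota : L -> R[i]).
Hypothesis iota_neq0 : {in GRing.unit, forall x, iota x != 0}.
Hypothesis iotaM : {in GRing.unit &, {morph iota : x y / x * y}}.
Hypothesis iota_inj : {in GRing.unit &, injective iota}.
Variables (n : nat) (rV : mx_representation F (SL2 F) n).

Lemma iota1 : iota 1 = 1.
Proof.
have u1 := unitr1 L; apply: (mulfI (iota_neq0 u1)).
by rewrite -iotaM // !mulr1.
Qed.

Lemma iotaX x k : x != 0 -> iota (x ^+ k) = iota x ^+ k.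
Proof.
move=> x0; elim: k => [|k IHk]; first exact: iota1.
by rewrite !exprS iotaM ?unitfE ?expf_neq0 // IHk.
Qed.

(** Injectivity of [iota] gives iota x != 1 when x != 1, and the geometric sum vanishes. *)
Lemma sum_iota_expr m x : x ^+ m = 1 ->
  \sum_(k < m) iota (x ^+ k) = m%:R * (x == 1)%:R.
Proof.
case: m => [|m] xm; first by rewrite big_ord0 mul0r.
have x0 : x != 0.
  by apply/eqP => x0; move/eqP: xm; rewrite x0 expr0n eq_sym oner_eq0.
have [->|x1] := eqVneq x 1.
  rewrite (eq_bigr (fun=> 1)) => [|k _]; last by rewrite expr1n iota1.
  by rewrite sumr_const card_ord mulr1.
rewrite mulr0; under eq_bigr => k _ do rewrite iotaX //.
have i1 : iota x - 1 != 0.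
  rewrite subr_eq0 -iota1; apply: contraNneq x1 => e; apply/eqP/iota_inj => //;
  by rewrite unitfE ?oner_neq0.
by apply: (mulfI i1); rewrite -subrX1 -iotaX // xm iota1 subrr mulr0.
Qed.

Lemma brauer_conj x y g : x \in SL2 F -> y \in SL2 F -> g \in SL2 F ->
  (g * x = y * g)%g ->
  brauer_character j iota rV x = brauer_character j iota rV y.
Proof.
move=> xG yG gG gx; rewrite /brauer_character.
suff -> : char_poly (map_mx j (rV x)) = char_poly (map_mx j (rV y)) by [].
apply: (@char_poly_similar _ _ (map_mx j (rV g))).
  by rewrite map_unitmx (repr_mx_unit rV).
by rewrite -!map_mxM -!(repr_mxM rV) ?gx.
Qed.

Lemma diag_intertwinesX (P : 'M[L]_n) (d : 'rV[L]_n) t k : t \in SL2 F ->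
  P *m map_mx j (rV t) = diag_mx d *m P ->
  P *m map_mx j (rV (t ^+ k)%g) = diag_mx (\row_i d 0 i ^+ k) *m P.
Proof.
move=> tG PB; elim: k => [|k IHk].
  rewrite expg0 (repr_mx1 rV) map_mx1 mulmx1 -[LHS]mul1mx; congr (_ *m _).
  by rewrite -diag_const_mx; congr diag_mx; apply/rowP => i; rewrite !mxE.
rewrite expgS (repr_mxM rV) ?groupX // map_mxM mulmxA PB -mulmxA IHk mulmxA.
congr (_ *m _); rewrite mulmx_diag; congr diag_mx.
by apply/rowP => i; rewrite !mxE exprS.
Qed.

(** The minimal polynomial of t divides X^m - 1, which has m distinct roots in L, the powers of
    z. *)
Lemma torus_diagonalizable m (z : L) t :
  m.-primitive_root z -> t \in SL2 F -> (t ^+ m = 1)%g ->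
  exists P d, [/\ P \in unitmx, P *m map_mx j (rV t) = diag_mx d *m P &
                 forall i, d 0 i ^+ m = 1].
Proof.
move=> pz tG tm; suff [P [d [Pu PB]]] : exists P (d : 'rV[L]_n),
    P \in unitmx /\ P *m map_mx j (rV t) = diag_mx d *m P.
  exists P, d; split=> // i; have := diag_intertwinesX m tG PB.
  rewrite tm (repr_mx1 rV) map_mx1 mulmx1 -{1}[P]mul1mx.
  move/(can_inj (mulmxK Pu))/matrixP/(_ i i); rewrite !mxE eqxx.
  by rewrite /= !mulr1n => <-.
case: n rV => [|n'] rW.
  by exists 1%:M, 0; rewrite unitmx1 [LHS]flatmx0 [RHS]flatmx0.
pose B := map_mx j (rW t); have Bk k : B ^+ k = map_mx j (rW (t ^+ k)%g).
  elim: k => [|k IHk]; first by rewrite expg0 (repr_mx1 rW) map_mx1.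
  by rewrite exprS IHk expgS (repr_mxM rW) ?groupX // map_mxM.
have /diagonalizableP [P Pu /diagonalizable_forPex[d /(simmxP Pu) PB]] :
    exists2 rs, uniq rs & mxminpoly B %| \prod_(x <- rs) ('X - x%:P).
  exists [seq z ^+ i | i <- index_iota 0 m].
    rewrite map_inj_in_uniq ?iota_uniq // => k l.
    rewrite !mem_index_iota /= => km lm /eqP.
    by rewrite (eq_prim_root_expr pz) !modn_small // => /eqP.
  rewrite big_map (factor_Xn_sub_1 pz); apply: mxminpoly_min.
  by rewrite rmorphB rmorphXn /= horner_mx_X rmorph1 Bk tm (repr_mx1 rW) map_mx1 subrr.
by exists P, d.
Qed.

Lemma sum_unity_roots (V : nmodType) m (z : L) (f : L -> V) : m.-primitive_root z ->
  \sum_(x : L | x ^+ m == 1) f x = \sum_(k < m) f (z ^+ k).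
Proof.
move=> pz; have im : [pred x : L | x ^+ m == 1] =i [set z ^+ (k : 'I_m) | k in [set: 'I_m]].
  move=> x; rewrite inE; apply/eqP/imsetP => [/(prim_rootP pz)[k ->]|[k _ ->]].
    by exists k.
  by rewrite exprAC (prim_expr_order pz) expr1n.
rewrite (eq_bigl _ _ im) big_imset /=; first by apply: eq_bigl => k; rewrite inE.
move=> k l _ _ /eqP; rewrite (eq_prim_root_expr pz) !modn_small //.
by move/eqP/val_inj.
Qed.

Lemma card_fix_diag (d : 'rV[L]_n) :
  #|[set y : 'cV[L]_n | diag_mx d *m y == y]| =
  (#|L| ^ #|[pred i : 'I_n | d 0%R i == 1%R]|)%N.
Proof.
pose h (f : {ffun 'I_n -> L}) : 'cV[L]_n := \col_i f i.
have h_inj : injective h.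
  by move=> f g /colP e; apply/ffunP => i; have := e i; rewrite !mxE.
pose A i : pred L := if d 0 i == 1 then predT else pred1 0.
have -> : [set y : 'cV[L]_n | diag_mx d *m y == y] = h @: family A.
  apply/setP => y; rewrite inE; apply/eqP/imsetP => [/colP dy|[f /familyP fA ->]].
    exists [ffun i => y i 0]; last by apply/colP => i; rewrite mxE ffunE.
    apply/familyP => i; rewrite ffunE /A; case: eqP => // /eqP di.
    have := dy i; rewrite mul_diag_mx mxE => /eqP.
    by rewrite -subr_eq0 -[X in _ - X]mul1r -mulrBl mulf_eq0 subr_eq0 (negPf di).
  apply/colP => i; rewrite mul_diag_mx !mxE.
  have := fA i; rewrite /A; case: eqP => [->|_]; first by rewrite mul1r.
  by rewrite inE => /eqP->; rewrite mulr0.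
rewrite (card_imset _ h_inj) card_family.
rewrite foldrE big_map big_enum /= -prod_nat_const [RHS]big_mkcond.
apply: eq_bigr => i _; rewrite /A inE; case: ifP => _; last by rewrite card1.
exact: eq_card.
Qed.

(** By conjugacy the sum of characters runs over the t^k with k < m. An eigenvalue c of t on V
    contributes the sum of the iota (c^k), which is m if c = 1 and 0 otherwise, so a is the
    multiplicity of 1, the dimension of the fixed space. *)
Lemma torus_mean m (z : L) t : m.-primitive_root z -> t \in SL2 F -> (t ^+ m = 1)%g ->
  (forall k, exists2 g, g \in SL2 F & (g * A_ j (z ^+ k)%R = t ^+ k * g)%g) ->
  exists2 a, #|[set x : 'cV[L]_n | map_mx j (rV t) *m x == x]| = (#|L| ^ a)%N &
    \sum_(x : L | x ^+ m == 1) brauer_character j iota rV (A_ j x) = m%:R * a%:R.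
Proof.
move=> pz tG tm tconj.
have [P [d [Pu PB dm]]] := torus_diagonalizable pz tG tm.
exists #|[pred i : 'I_n | d 0%R i == 1%R]|.
  rewrite -card_fix_diag -(card_imset _ (can_inj (mulKmx Pu))).
  apply: eq_card => y; apply/imsetP/idP => [[x]|].
    rewrite !inE => /eqP xE ->; apply/eqP.
    by rewrite mulmxA -PB -mulmxA xE.
  rewrite inE => /eqP yE; exists (invmx P *m y); last by rewrite mulKVmx.
  rewrite inE; apply/eqP; apply: (can_inj (mulKmx Pu)).
  by rewrite mulmxA PB -mulmxA !mulKVmx.
rewrite (sum_unity_roots _ pz).
have ch k : brauer_character j iota rV (A_ j (z ^+ k)) = \sum_i iota (d 0 i ^+ k).
  have [g gG gA] := tconj k.
  rewrite (brauer_conj _ _ gG gA) ?A_SL2 ?groupX // /brauer_character.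
  have Pk := diag_intertwinesX k tG PB.
  rewrite (char_poly_similar Pu Pk) char_poly_trig ?diag_mx_is_trig //.
  rewrite (eq_bigr (fun i => 'X - (d 0 i ^+ k)%:P)) => [|i _]; last first.
    by rewrite !mxE eqxx mulr1n.
  exact: sum_roots_prod_XsubC.
under eq_bigr => k _ do rewrite ch.
rewrite exchange_big /=; under eq_bigr => i _ do rewrite sum_iota_expr //.
rewrite -mulr_sumr -natr_sum -sum1_card [in RHS]big_mkcond.
by congr (_ * _%:R); apply: eq_bigr => i _; rewrite inE; case: eqP.
Qed.

End TorusMean.

(** * The two maximal tori *)

Section Tori.
Variables (p e N : nat) (F L : finFieldType) (j : {rmorphism F -> L}).
Hypothesis p_prime : prime p.
Hypothesis cardFp : #|F| = (p ^ e)%N.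
Hypothesis cardF : #|F| = N.+1.
Hypothesis cardL : #|L| = (N.+1 ^ 2)%N.
Hypothesis chL : [pchar L].-nat N.+1.
Variables (R : realType) (iota : L -> R[i]).
Hypothesis iota_neq0 : {in GRing.unit, forall x, iota x != 0}.
Hypothesis iotaM : {in GRing.unit &, {morph iota : x y / x * y}}.
Hypothesis iota_inj : {in GRing.unit &, injective iota}.
Variables (n : nat) (rV : mx_representation F (SL2 F) n).

Local Notation rVL := (map_repr j (rV : mx_representation F (SL2_group F) n)).
Let N_gt0 := finField_predC_gt0 cardF.

(** The hypothesis says that x is a root of X^2 - t X + 1, the characteristic polynomial of the
    companion matrix. *)
Lemma companion_row (t : F) (x : L) : x * x + 1 = j t * x ->
  row2 1 x *m map_mx j (companion_mx t) = x *: row2 1 x.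
Proof.
move=> xt; apply: rV2P; rewrite mulmx_rV2 !mxE /=.
  by rewrite rmorph0 rmorph1 !mul1r add0r mulr1.
by rewrite rmorphN rmorph1 mul1r mulrC -xt addrC addrK.
Qed.

Lemma vact_A_eigen (x y : L) : (x ^+ N == 1) || (x ^+ N.+2 == 1) ->
  x != 1 -> x != -1 -> (y == x) || (y == x^-1) ->
  vact j (row2 1 y) (A_ j x) = y *: row2 1 y.
Proof.
move=> xN x1 xN1 xy; rewrite /vact /A_ (negPf x1) (negPf xN1) /=.
have x0 : x != 0.
  apply: contraTneq xN => ->.
  by rewrite !expr0n gtn_eqF //= eq_sym oner_eq0.
apply: companion_row; rewrite (trace_descend j p_prime cardFp) ?cardF //.
by case/orP: xy => /eqP->; rewrite mulrDl ?divff ?mulVf // addrC.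
Qed.

Lemma vact_A_scalar (x : L) w : (x == 1) || (x == -1) -> vact j w (A_ j x) = x *: w.
Proof.
rewrite /A_ => /orP[/eqP->|/eqP->]; first by rewrite eqxx vact1 scale1r.
rewrite eqxx; case: eqP => [e1|_]; first by rewrite vact1 e1 scale1r.
by rewrite /vact /= map_mxN map_mx1 mulmxN mulmx1 scaleN1r.
Qed.

Lemma vact_conj_eigen (w u : 'rV[L]_2) g h x : vsim (vact j w g) u ->
  vact j u h = x *: u -> vact j w (g * h * g^-1)%g = x *: w.
Proof.
rewrite vsim_sym => /vsimP[a a0 wg] uh.
by rewrite !vactM wg vactZ uh scalerA mulrC -scalerA -wg vactZ -vactM mulgV vact1.
Qed.

(* eig g a says that s0 is an eigenvector of g for a; it embeds the stabiliser
   of the class of s0 into the m-th roots of unity. *)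
Lemma torus_case m z t (S : gset {'GL_2[F]}) (s0 : S) (eig : {'GL_2[F]} -> L -> Prop) :
  m.-primitive_root z -> t \in SL2 F -> eig t z ->
  (forall g h a, eig g a -> eig h a -> g = h) ->
  eig 1%g 1 -> (forall g h a b, eig g a -> eig h b -> eig (g * h)%g (a * b)) ->
  gsim (gact s0 t) s0 ->
  (forall g, g \in SL2 F -> gsim (gact s0 g) s0 -> exists2 a, a ^+ m = 1 & eig g a) ->
  (forall k, exists2 g, g \in SL2 F & eig (g * A_ j (z ^+ k)%R * g^-1)%g (z ^+ k)) ->
  exists2 a, #|stab_fix rVL s0| = (#|L| ^ a)%N &
    \sum_(x : L | x ^+ m == 1) brauer_character j iota rV (A_ j x) = m%:R * a%:R.
Proof.
move=> pz tG tz einj e1 eM st stabE conjE.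
have eX k : eig (t ^+ k)%g (z ^+ k).
  by elim: k => [|k IHk]; rewrite ?expg0 // expgS exprS; apply: eM.
have tm : (t ^+ m = 1)%g.
  by apply: (einj _ _ 1) => //; rewrite -(prim_expr_order pz).
have [|a aE sE] := torus_mean (j := j) iota_neq0 iotaM iota_inj rV pz tG tm.
  move=> k; have [g gG ge] := conjE k; exists g => //.
  by rewrite -(einj _ _ _ ge (eX k)) mulgKV.
exists a => //; rewrite -aE; apply: eq_card => x.
apply/stab_fixP/idP => [xfix|].
  by rewrite inE; apply/eqP/(xfix t tG).
rewrite inE => /eqP xt g gG gs.
have [b bm gb] := stabE g gG gs; have [k bk] := prim_rootP pz bm.
have -> : g = (t ^+ k)%g by apply: einj gb _; rewrite bk.
elim: (nat_of_ord k) => [|i IHi]; first by rewrite expg0 repr_mx1 mul1mx.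
by rewrite expgS repr_mxM ?groupX // -mulmxA IHi.
Qed.

(** The stabiliser of the two axes is the diagonal torus, generated by diag(z, z^-1). For x in
    mu_(q-1) other than 1 and -1, [A_ j x] has the two distinct eigenlines of (1, x) and (1, x^-1)
    over F, and an element of SL_2(F) carries the axes to them. *)
Lemma split_torus : exists2 a, #|stab_fix rVL (axes F)| = (#|L| ^ a)%N &
  \sum_(x : L | x ^+ N == 1) brauer_character j iota rV (A_ j x) = N%:R * a%:R.
Proof.
have [z pz] := finField_prim_root cardF.
have z0 : z != 0 by rewrite (prim_root_eq0 pz) -lt0n.
pose h : 'M[F]_2 := \matrix_(i, k) (if i == k then (if i == 0 then z else z^-1) else 0).
have [t tG th] : exists2 t, t \in SL2 F & GLval t = h.
  by apply: SL2_of_mx; rewrite det_mx22 !mxE /= mulfV // mulr0 subr0.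
pose eig g a := vact j (row2 1 0) g = a *: row2 1 0 /\
                vact j (row2 0 1) g = a^-1 *: row2 0 1.
have jrow a b : map_mx j (row2 a b) = row2 (j a) (j b).
  by apply: rV2P; rewrite !mxE.
have row10 (A : 'M[L]_2) : row2 1 0 *m A = row 0 A by rewrite row2M scale1r scale0r addr0.
have row01 (A : 'M[L]_2) : row2 0 1 *m A = row 1 A by rewrite row2M scale1r scale0r add0r.
have simj (u v : 'rV[F]_2) : vsim u v -> vsim (map_mx j u) (map_mx j v).
  by rewrite !vsimE rdet_map fmorph_eq0 !map_mx_eq0.
apply: (@torus_case N (j z) t _ _ eig) => //.
- by rewrite fmorph_primitive_root.
- split; rewrite /vact th ?row10 ?row01; apply: rV2P; rewrite !mxE /=;
  by rewrite ?mulr1 ?mulr0 ?rmorph0 ?fmorphV.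
- move=> g k a [g0 g1] [k0 k1]; apply: val_inj; apply/matrixP => x y.
  apply: (fmorph_inj j).
  have e0 : row 0 (map_mx j (GLval g)) = row 0 (map_mx j (GLval k)).
    by rewrite -!row10 [LHS]g0 -k0.
  have e1 : row 1 (map_mx j (GLval g)) = row 1 (map_mx j (GLval k)).
    by rewrite -!row01 [LHS]g1 -k1.
  case: x => -[|[|//]] ltx.
    have := congr1 (fun w : 'rV[L]_2 => w 0 y) e0; rewrite !mxE.
    by have -> : Ordinal ltx = 0 by apply: val_inj.
  have := congr1 (fun w : 'rV[L]_2 => w 0 y) e1; rewrite !mxE.
  by have -> : Ordinal ltx = 1 by apply: val_inj.
- by split; rewrite vact1 ?invr1 scale1r.
- move=> g k a b [g0 g1] [k0 k1]; split; rewrite vactM ?g0 ?g1 vactZ ?k0 ?k1 scalerA //.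
  by rewrite invfM.
- have tE (u : 'rV[F]_2) : vact (idfun : {rmorphism F -> F}) u t = u *m h.
    by rewrite /vact th; congr (_ *m _); apply/matrixP => a b; rewrite mxE.
  rewrite /= /psim /=; apply/andP; split; rewrite vsim_sym; apply/vsimP.
    by exists z => //; rewrite tE; apply: rV2P; rewrite mulmx_rV2 !mxE /=; ring.
  exists z^-1; first by rewrite invr_eq0.
  by rewrite tE; apply: rV2P; rewrite mulmx_rV2 !mxE /=; ring.
- move=> g gG /andP[/= s1 s2].
  have := simj _ _ s1; rewrite vsim_sym vact_map jrow => /vsimP[a a0 ae].
  have := simj _ _ s2; rewrite vsim_sym vact_map jrow => /vsimP[b b0 be].
  rewrite !rmorph1 !rmorph0 in ae be.
  have ab : a * b = 1.
    have := rdet_vact j (row2 1 0) (row2 0 1) gG.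
    have rd : rdet (row2 1 0) (row2 0 1) = 1 :> L by rewrite /rdet !mxE /= mul0r mulr1 subr0.
    by rewrite ae be rdetZl rdetZr rd mulr1.
  have bE : b = a^-1 by apply: (mulfI a0); rewrite ab divff.
  exists a; last by rewrite /eig -bE.
  (* The eigenvalue is an entry of g, so it comes from F and its (q-1)-th power is 1. *)
  have aF : exists a', a = j a'.
    exists (GLval g 0 0); have := congr1 (fun w : 'rV[L]_2 => w 0 0) ae.
    by rewrite /= /vact row10 !mxE /= mulr1.
  case: aF a0 => a' -> a0'; rewrite -rmorphXn (expr_predC cardF).
  by move: a0'; rewrite fmorph_eq0 => ->; rewrite rmorph1.
move=> k; rewrite -rmorphXn; set x := z ^+ k.
have x0 : x != 0 by rewrite expf_neq0.
have xN : (j x ^+ N == 1) || (j x ^+ N.+2 == 1).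
  by rewrite -rmorphXn (expr_predC cardF) x0 rmorph1 eqxx.
have [xs|] := boolP ((j x == 1) || (j x == -1)).
  exists 1%g; first exact: group1.
  rewrite invg1 mulg1 mul1g; split; rewrite vact_A_scalar //.
  by case/orP: xs => /eqP->; rewrite ?invr1 ?invrN1.
rewrite negb_or => /andP[x1 xN1].
(* The determinant is x^-1 - x, which vanishes only if x^2 = 1. *)
have dx : rdet (row2 1 x) (row2 1 x^-1) != 0.
  rewrite /rdet !mxE /= mul1r mulr1 subr_eq0; apply: contra x1 => /eqP xx.
  have : (x - 1) * (x + 1) == 0.
    by rewrite -subr_sqr expr1n subr_eq0 expr2 -{1}xx mulVf.
  rewrite mulf_eq0 subr_eq0 addr_eq0 => /orP[/eqP->|/eqP xE]; first by rewrite rmorph1.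
  by case/eqP: xN1; rewrite xE rmorphN rmorph1.
have [g gG /andP[/= s1 s2]] := axes_transitive dx.
exists g => //; split.
  apply: (@vact_conj_eigen _ (row2 1 (j x))).
    by have := simj _ _ s1; rewrite vact_map !jrow !rmorph1 rmorph0.
  by apply: vact_A_eigen; rewrite ?eqxx.
apply: (@vact_conj_eigen _ (row2 1 (j x)^-1)).
  by have := simj _ _ s2; rewrite vact_map !jrow fmorphV !rmorph1 rmorph0.
by apply: vact_A_eigen; rewrite ?eqxx ?orbT.
Qed.

Lemma nonsplit_root : exists z : L, N.+2.-primitive_root z.
Proof.
have cardL' : #|L| = (N.+2 * N).+1.
  by rewrite cardL expnS expn1 !mulSn mulnS addSn addnA [(N + _ + _)%N]addnC.
have [z pz] := finField_prim_root cardL'; exists (z ^+ N).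
have := dvdn_prim_root pz (dvdn_mulr N (dvdnn N.+2)).
by rewrite mulKn.
Qed.

(** Here [delta] at (1, x) is x^q - x, and x^(q+1) = 1 makes it x^-1 - x. *)
Lemma delta_row2 (x : L) : x ^+ N.+2 = 1 -> x != 1 -> x != -1 ->
  delta N (row2 1 x) != 0.
Proof.
move=> xN x1 xN1; rewrite /delta !mxE /= mul1r expr1n mulr1 subr_eq0.
have x0 : x != 0 by apply/eqP => x0; move/eqP: xN; rewrite x0 expr0n eq_sym oner_eq0.
apply: contra x1 => /eqP xx; have : (x - 1) * (x + 1) == 0.
  by rewrite -subr_sqr expr1n subr_eq0 expr2 -{2}xx -exprS xN.
rewrite mulf_eq0 subr_eq0 addr_eq0 => /orP[//|/eqP xE].
by case/eqP: xN1.
Qed.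

Lemma prim_root_neq_pm1 (z : L) : N.+2.-primitive_root z -> (z != 1) && (z != -1).
Proof.
move=> pz; have z2 : z ^+ 2 != 1.
  rewrite -(prim_order_dvd pz); apply/negP => /dvdn_leq-/(_ isT).
  by rewrite !ltnS leqn0 => /eqP NE; move: N_gt0; rewrite NE.
by apply/andP; split; apply: contraNneq z2 => ->; rewrite ?sqrrN expr1n.
Qed.

(** The generator is [A_ j z] itself, with eigenvector (1, z). An element of SL_2(F) is determined
    by its eigenvalue on (1, z), since 1 and z are independent over F, and [delta] shows that this
    eigenvalue is in mu_(q+1). *)
Lemma nonsplit_torus (z : L) : N.+2.-primitive_root z ->
  exists2 a, #|stab_fix rVL (row2 1 z : lines j)| = (#|L| ^ a)%N &
  \sum_(x : L | x ^+ N.+2 == 1) brauer_character j iota rV (A_ j x) = N.+2%:R * a%:R.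
Proof.
move=> pz; have zm := prim_expr_order pz.
have /andP[z1 zN1] := prim_root_neq_pm1 pz.
have d0 := delta_row2 zm z1 zN1.
pose eig g a := vact j (row2 1 z) g = a *: row2 1 z.
have eigt : eig (A_ j z) z by apply: vact_A_eigen; rewrite ?zm ?eqxx ?orbT.
have z0 : z != 0 by rewrite (prim_root_eq0 pz).
apply: (@torus_case N.+2 z (A_ j z) (lines j) _ eig) => //.
- exact: A_SL2.
- move=> g h a ga ha; apply: val_inj; apply/matrixP => x y /=.
  have := congr1 (fun w : 'rV[L]_2 => w 0 y) (etrans ga (esym ha)).
  rewrite /= /vact !mulmx_rV2 !mxE /= !mul1r => /eqP.
  rewrite -subr_eq0 opprD addrACA -mulrBr -!rmorphB => /eqP e0.
  have nF (a0 : F) : j a0 != z.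
    apply: contraNneq d0 => <-; rewrite -(rmorph1 j).
    have -> : row2 (j 1) (j a0) = map_mx j (row2 1 a0) by apply: rV2P; rewrite !mxE.
    by rewrite (delta_map j cardF).
  have [/eqP e1 /eqP e2] := quadratic_inj nF e0.
  move: e1 e2; rewrite !subr_eq0 => /eqP e1 /eqP e2.
  case: x => -[|[|//]] ltx.
    by have -> : Ordinal ltx = 0 by apply: val_inj.
  by have -> : Ordinal ltx = 1 by apply: val_inj.
- by rewrite /eig vact1 scale1r.
- by move=> g h a b ga hb; rewrite /eig vactM ga vactZ hb scalerA.
- by rewrite gsim_sym; apply/vsimP; exists z.
- move=> g gG; rewrite gsim_sym => /vsimP[a a0 ga]; exists a => //.
  (* Determinant 1 preserves [delta], while scaling by a multiplies it by a^(q+1); as [delta] is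
     nonzero at (1, z), a^(q+1) = 1. *)
  have := deltaM j cardF chL (row2 1 z) (GLval g).
  rewrite SL2_det // rmorph1 mul1r [_ *m _]ga deltaZ => /eqP.
  by rewrite -[eqbRHS]mul1r -subr_eq0 -mulrBl mulf_eq0 (negPf d0) orbF subr_eq0 => /eqP.
move=> k; set x := z ^+ k.
have xm : x ^+ N.+2 = 1 by rewrite /x exprAC zm expr1n.
have [xs|] := boolP ((x == 1) || (x == -1)).
  exists 1%g; first exact: group1.
  by rewrite invg1 mulg1 mul1g /eig vact_A_scalar.
rewrite negb_or => /andP[x1 xN1].
have [g gG gs] := nonrational_transitive j cardF cardL chL d0 (delta_row2 xm x1 xN1).
exists g => //; apply: vact_conj_eigen gs _.
by apply: vact_A_eigen; rewrite ?xm ?eqxx ?orbT.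
Qed.

End Tori.

(** * Comparison of the fixed spaces of the two tori *)

Theorem theorem5p3 (p e q : nat) (p_prime : prime p) (e_gt0 : (0 < e)%N)
    (q_def : q = (p ^ e)%N)
    (F L : finFieldType) (cardF : #|F| = q) (cardL : #|L| = (q ^ 2)%N)
    (j : {rmorphism F -> L})
    (R : realType) (iota : L -> R[i])
    (iota_neq0 : {in GRing.unit, forall x, iota x != 0})
    (iotaM : {in GRing.unit &, {morph iota : x y / x * y}})
    (iota_inj : {in GRing.unit &, injective iota})
    (n : nat) (rV : mx_representation F (SL2 F) n) :
  (\dim (Hom_steinberg p rV))%:R =
    2^-1 * ((q%:R - 1)^-1 *
              \sum_(z : L | z ^+ (q - 1) == 1)
                 brauer_character j iota rV (A_ j z)
            - (q%:R + 1)^-1 *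
              \sum_(z : L | z ^+ (q + 1) == 1)
                 brauer_character j iota rV (A_ j z)) :> R[i].
Proof.
set d := \dim _; pose N := q.-1.
have qN : q = N.+1 by rewrite prednK // q_def expn_gt0 prime_gt0.
have cardFp : #|F| = (p ^ e)%N by rewrite cardF.
have cF : #|F| = N.+1 by rewrite cardF.
have cL : #|L| = (N.+1 ^ 2)%N by rewrite cardL qN.
have cLF : #|L| = (#|F| ^ 2)%N by rewrite cardL cardF.
have chL : [pchar L].-nat N.+1.
  rewrite -qN q_def pnatX pnatE //; apply/orP; left.
  by rewrite (fmorph_pchar j); apply: card_finPcharP cardFp p_prime.
have N_gt0 := finField_predC_gt0 cF.
pose r := map_repr j (rV : mx_representation F (SL2_group F) n).
have [z pz] := nonsplit_root cL.
have /andP[z1 zN1] := prim_root_neq_pm1 cF pz.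
have d0 := delta_row2 (prim_expr_order pz) z1 zN1.
have [a aE aS] := split_torus j p_prime cardFp cF iota_neq0 iotaM iota_inj rV.
have [b bE bS] := nonsplit_torus j p_prime cardFp cF cL chL iota_neq0 iotaM iota_inj rV pz.
have nF (c : F) : j c != z.
  apply: contraNneq d0 => <-; rewrite -(rmorph1 j).
  have -> : row2 (j 1) (j c) = map_mx j (row2 1 c) by apply: rV2P; rewrite !mxE.
  by rewrite (delta_map j cF).
have E0 : #|equivariant0 r (projline F)| = (#|L| ^ d)%N.
  rewrite (card_equivariant0_extend cLF _ nF) (card_Hom_steinberg rV p_prime cardFp).
  by rewrite -expnM mulnC expnM cLF.
(* This cardinal is the common factor of both orbit decompositions; it has to be nonzero to be
   cancelled. *)
have E1 : (0 < #|equivariant r (projline F)|)%N.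
  apply/card_gt0P; exists 0; apply/equivariantP.
  by split=> [s _|s t _|g s _]; rewrite !ffunE ?mulmx0.
(* After cancellation the transform reads |L|^a = |L|^b |L|^d |L|^d. *)
have abd : a = (b + 2 * d)%N.
  have := card_equivariant_transform j cF cL chL r.
  rewrite card_equivariant_pairs (card_equivariant_lines j cF cL chL r d0) aE bE E0.
  rewrite -!mulnA => /eqP; rewrite eqn_pmul2l // -!expnD eqn_exp2l.
    by move/eqP->; rewrite mul2n -addnn.
  exact: finNzRing_gt1.
have N0 : N%:R != 0 :> R[i] by rewrite pnatr_eq0 -lt0n.
have N20 : N.+2%:R != 0 :> R[i] by rewrite pnatr_eq0.
have -> : q%:R - 1 = N%:R :> R[i] by rewrite qN -natr1 addrK.
have -> : q%:R + 1 = N.+2%:R :> R[i] by rewrite natr1 qN.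
rewrite qN subn1 addn1 aS bS !mulKf // -natrB ?abd ?leq_addr //.
by rewrite addKn natrM mulKf // pnatr_eq0.
Qed.
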